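(* Every realization graph is homogeneously traceable: for every graphical degree function $d$ and every realization $G$ of $d$, there is a Hamilton path of $G(d)$ beginning at $G$.
   Context: All graphs are finite and simple. A degree function on a finite set $V$ with $|V|=n$ is a map $d:V\to\{0,1,\dots,n-1\}$; it is graphical if some simple graph on vertex set $V$ has $\deg(u)=d(u)$ for all $u\in V$. Such a (labeled) graph is a realization of $d$. The realization graph $G(d)$ has as vertices all realizations of $d$; two realizations are adjacent when the symmetric difference of their edge sets has exactly four elements (equivalently, they differ by a single 2-switch, replacing edges $ab,cd$ on four distinct vertices by non-edges $ad,cb$). A one-vertex path counts as a Hamilton path of the one-vertex graph. *)

(* Defs.v *)
From mathcomp Require Import all_boot.

Set Implicit Arguments.
Unset Strict Implicit.
Unset Printing Implicit Defensive.

Section Realizations.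
Variable V : finType.
Implicit Types E F : {set {set V}}.

(* A labeled graph on V is given by its edge set, an edge being the
   two-element set of its ends. *)
Definition simple_graph E : bool := [forall e in E, #|e| == 2].

Definition deg E (u : V) : nat := #|[set e in E | u \in e]|.

Definition symdiff E F : {set {set V}} := (E :\: F) :|: (F :\: E).

Variable d : V -> 'I_#|V|.

Definition is_realization E : bool :=
  simple_graph E && [forall u, deg E u == d u].

Definition graphical : Prop := exists E, is_realization E.

Definition realization : finType := {E : {set {set V}} | is_realization E}.

(* The adjacency relation of the realization graph G(d). *)
Definition realization_graph : rel realization :=
  fun G H => #|symdiff (val G) (val H)| == 4.

Lemma realization_graph_sym : symmetric realization_graph.
Proof. by move=> G H; rewrite /realization_graph /symdiff setUC. Qed.

Lemma realization_graph_irrefl : irreflexive realization_graph.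
Proof. by move=> G; rewrite /realization_graph /symdiff setDv setU0 cards0. Qed.

End Realizations.

Section Traceability.
Variables (T : finType) (e : rel T).

(* The vertex sequence x :: p is a Hamilton path of e beginning at x; p = [::]
   is allowed when T has a single element. *)
Definition hamilton_path (x : T) (p : seq T) : bool :=
  [&& path e x p, uniq (x :: p) & [forall y, y \in x :: p]].

Definition homogeneously_traceable : Prop :=
  forall x : T, exists p : seq T, hamilton_path x p.

End Traceability.

(* Main.v *)
Require Import Defs.
From mathcomp Require Import all_boot zify.

(** Let A be a set of free vertices and let [completions A G] consist of the
graphs that have the degrees of G and agree with G on all pairs not inside A.
For distinct a, b in A call a graph an exit for (a, b) if some vertex of A
other than a is adjacent to b but not to a. By induction on A, every member of
[completions A G] starts a Hamilton path of [completions A G] ([ham_from]),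
and if there are exits for (a, b), such a path can be made to end at one of
them ([ham_exit]). The theorem is the case where all vertices are free.

Choose v in A. The sets N(v) :&: A, called labels, split the completions into
fibres, which are completion sets for A - v. A 2-switch leads from a graph
with label S to one with label S - u + u' exactly when the graph is an exit for
(u, u') within A - v. If both labels occur, the fibre of S contains such an
exit: a switch at v that trades a neighbour for a vertex of at least the same
degree is always available, and its reverse starts at an exit ([exit_step]).
So the induction hypothesis traverses the fibre of S and leaves it towards
S - u + u', and every Hamilton path in the exchange graph of the family of
labels lifts to the completions ([lift_hpath]). Only the last fibre has to be
chosen with care.

The same switches show that the family of labels is shifted with respect to
the order by degree. In a shifted family every member starts a Hamilton path
of the exchange graph, and the top member T is joined by one to every other
member S, with a single kind of exception ([shifted_hpaths]): the family may
be pinched, which means that its exchange graph consists of two cliques that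
share exactly T and T - a + b, and S = T - a + b.

For the exits, let d(a) >= d(b); otherwise every graph is an exit. Some
completion has a vertex c adjacent to b and not to a, hence also a vertex w
adjacent to a and not to b. Let v be c or w. The label of v in some completion
contains b and not a, and all graphs with such a label are exits; moreover the
fibre of T contains an exit ([top_exit]). So there is a fibre at which to end,
unless the labels of v are pinched at (a, b) ([end_choice]). This cannot happen
for both c and w: it forces d(b) <= d(v) <= d(a) and keeps the degrees of all
other vertices out of that interval ([pinched_degree]). *)

Set Implicit Arguments.
Unset Strict Implicit.
Unset Printing Implicit Defensive.

(** * Hamilton paths of vertex sets *)

Section HamPaths.
Variables (T : finType) (e : rel T).
Implicit Types (X Y : {set T}) (x y z : T).

Definition hpath X x y : Prop :=
  exists p, [/\ path e x p, uniq (x :: p), x :: p =i X & last x p = y].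

Lemma hpath_end X x y : hpath X x y -> y \in X.
Proof. by case=> p [_ _ <- <-]; rewrite mem_last. Qed.

Lemma hpath1 x : hpath [set x] x x.
Proof. by exists [::]; split=> // z; rewrite !inE. Qed.

Lemma hpath_cat X Y x y z t :
  hpath X x y -> e y z -> hpath Y z t -> [disjoint X & Y] -> hpath (X :|: Y) x t.
Proof.
case=> p [pp up pX lp] eyz [q [pq uq qY lq]] dXY.
exists (p ++ z :: q); split.
- by rewrite cat_path pp /= lp eyz.
- rewrite -cat_cons cat_uniq up uq andbT.
  apply/hasPn=> w wq; apply/negP=> wp.
  by have := disjointFr dXY (x := w); rewrite -pX -qY wq => /(_ wp).
- by move=> w; rewrite -cat_cons mem_cat pX qY inE.
- by rewrite last_cat.
Qed.

Lemma hpath_rev X x y : symmetric e -> hpath X x y -> hpath X y x.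
Proof.
move=> sym_e [p [pp up pX lp]]; exists (rev (belast x p)).
have E : y :: rev (belast x p) = rev (x :: p).
  by rewrite [x :: p]lastI rev_rcons lp.
split.
- rewrite -{1}lp (eq_path (e' := fun u v => e v u)) ?rev_path //.
- by rewrite E rev_uniq.
- by move=> w; rewrite E mem_rev.
- by case: p lp {pp up pX E} => //= z p _; rewrite rev_cons last_rcons.
Qed.

Lemma hpath_clique X x y :
    {in X &, forall u v, u != v -> e u v} -> x \in X -> y \in X -> x != y ->
  hpath X x y.
Proof.
move=> clX xX yX nxy.
pose m := enum (X :\ x :\ y).
have mE w : (w \in m) = [&& w != y, w != x & w \in X] by rewrite mem_enum !inE.
have pathm : forall q w, uniq (w :: q) -> {subset w :: q <= X} -> path e w q.
  elim=> //= z q IH w /andP[]; rewrite inE negb_or => /andP[nwz wq] uq sX.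
  apply/andP; split; first by rewrite clX // sX // !inE eqxx ?orbT.
  by apply: IH => // t tq; apply: sX; rewrite inE tq orbT.
have um : uniq (x :: rcons m y).
  rewrite /= mem_rcons rcons_uniq inE negb_or nxy /= !mE eqxx /=.
  by rewrite eqxx andbF /= enum_uniq.
have mX : x :: rcons m y =i X.
  move=> w; rewrite inE mem_rcons inE mE.
  by case: (w =P x) => [->|_]; rewrite ?xX //; case: (w =P y) => [->|].
exists (rcons m y); split=> //; last by rewrite last_rcons.
by apply: pathm => // w; rewrite mX.
Qed.

End HamPaths.

Section Lifting.
Variables (T L : finType) (e : rel T) (eL : rel L) (f : T -> L) (X : {set T}).
Variable good : T -> Prop.

(** A Hamilton path of the quotient lifts if every fibre can be traversed from
any entry point so as to reach the next fibre; the path is assembled fibre by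
fibre, and the second hypothesis governs where it stops. *)
Lemma hpath_lift x l :
    let fib k := [set z in X | f z == k] in
    (forall y k, y \in X -> k \in f @: X -> eL (f y) k ->
      exists z t, [/\ hpath e (fib (f y)) y z, t \in fib k & e z t]) ->
    (forall y, y \in fib l -> exists2 z, hpath e (fib l) y z & good z) ->
    x \in X -> hpath eL (f @: X) (f x) l ->
  exists2 z, hpath e X x z & good z.
Proof.
move=> fib step fin xX [p [pp up pX lp]].
suff H : forall p k y, y \in fib k -> path eL k p -> uniq (k :: p) ->
    {subset k :: p <= f @: X} -> last k p = l ->
    exists2 z, hpath e [set z in X | f z \in k :: p] y z & good z.
  have xf : x \in fib (f x) by rewrite inE xX eqxx.
  have sX : {subset f x :: p <= f @: X} by move=> k; rewrite pX.
  have [z hz gz] := H p (f x) x xf pp up sX lp.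
  exists z => //; congr (hpath e _ x z) : hz; apply/setP=> w; rewrite inE pX.
  by case wX: (w \in X); rewrite /= ?(imset_f f wX).
elim=> [|k' {pp up pX lp}p IH] k y yk /=.
  move=> _ _ _ kl; subst k; have [z hz gz] := fin y yk; exists z => //.
  by congr (hpath e _ y z) : hz; apply/setP=> w; rewrite !inE.
case/andP=> ekk' pp /andP[kp up] sX lp.
move: (yk); rewrite inE => /andP[yX /eqP fy].
have k'X : k' \in f @: X by apply: sX; rewrite !inE eqxx orbT.
have [|z [t [hz tk ezt]]] := step y k' yX k'X; first by rewrite fy.
have sX' : {subset k' :: p <= f @: X}.
  by move=> w wp; apply: sX; rewrite inE wp orbT.
have [z' hz' gz'] := IH k' t tk pp up sX' lp.
exists z' => //; rewrite fy in hz.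
have -> : [set z0 in X | f z0 \in k :: k' :: p]
    = fib k :|: [set z0 in X | f z0 \in k' :: p].
  by apply/setP=> w; rewrite !inE -andb_orr.
apply: hpath_cat hz ezt hz' _.
rewrite -setI_eq0; apply/eqP/setP=> w; rewrite !inE.
apply/negP=> /andP[/andP[_ /eqP->] /andP[_]].
by move: kp; rewrite inE => /negbTE->.
Qed.

End Lifting.

(** * Shifted families and their exchange graphs *)

Section Exchange.
Variable V : finType.
Implicit Types (S T : {set V}) (u w : V).

Definition swap S u w := w |: (S :\ u).

Definition exchange S T := (#|S :\: T| == 1) && (#|T :\: S| == 1).

Lemma exchange_sym : symmetric exchange.
Proof. by move=> S T; rewrite /exchange andbC. Qed.

Lemma in_swap S u w x : (x \in swap S u w) = (x == w) || (x != u) && (x \in S).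
Proof. by rewrite !inE. Qed.

Lemma card_swap S u w : u \in S -> w \notin S -> #|swap S u w| = #|S|.
Proof.
move=> uS wS; rewrite cardsU1 !inE (negbTE wS) andbF /=.
by rewrite (cardsD1 u S) uS.
Qed.

Lemma swapDl S u w : u \in S -> w \notin S -> S :\: swap S u w = [set u].
Proof.
move=> uS wS; apply/setP=> x; rewrite !inE.
case: (x =P u) => [->|_]; rewrite /= ?uS.
  by rewrite orbF andbT; apply: contraNneq wS => <-.
by case: (x \in S); rewrite ?orbT ?andbF.
Qed.

Lemma swapDr S u w : u \in S -> w \notin S -> swap S u w :\: S = [set w].
Proof.
move=> uS wS; apply/setP=> x; rewrite !inE.
by case: (x =P w) => [->|_] /=; [rewrite wS|case: (x \in S); rewrite ?andbF].
Qed.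

Lemma exchange_swap S u w : u \in S -> w \notin S -> exchange S (swap S u w).
Proof. by move=> uS wS; rewrite /exchange swapDl // swapDr // !cards1. Qed.

Lemma swap_of_setD S T u w :
  S :\: T = [set u] -> T :\: S = [set w] -> T = swap S u w.
Proof.
move=> /setP ST /setP TS; apply/setP=> x.
by move: (ST x) (TS x); rewrite !inE => <- <-; case: (x \in S); case: (x \in T).
Qed.

Lemma exchangeP S T : exchange S T ->
  exists u w, [/\ u \in S, w \notin S & T = swap S u w].
Proof.
case/andP=> /cards1P[u Eu] /cards1P[w Ew]; exists u, w.
have : u \in S :\: T by rewrite Eu inE.
have : w \in T :\: S by rewrite Ew inE.
rewrite !inE => /andP[wS _] /andP[_ uS].
by split=> //; apply: swap_of_setD.
Qed.

Lemma swap_swap S u w x : u \in S -> w \notin S -> w != x ->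
  swap (swap S u w) w x = swap S u x.
Proof.
move=> uS wS nwx; apply/setP=> y; rewrite !in_swap.
case: (y =P x) => //= _; case: (y =P w) => [->|_] //=.
by rewrite (negbTE wS) andbF.
Qed.

Lemma card_setD S T : #|S| = #|T| -> #|S :\: T| = #|T :\: S|.
Proof. by move=> E; have := cardsID T S; have := cardsID S T; rewrite setIC; lia. Qed.

Lemma setD_witness S T : #|S| = #|T| -> S != T -> exists u, u \in S :\: T.
Proof.
move=> cE nST; apply/set0Pn; apply: contraNneq nST => /eqP.
by rewrite setD_eq0 => sST; rewrite eqEcard sST cE /=.
Qed.

End Exchange.

Section Shifted.
Variables (V : finType) (r : V -> nat).
Hypothesis r_inj : injective r.
Implicit Types (S T D X : {set V}) (F : {set {set V}}) (u w a b e f t : V).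
Local Notation hp := (hpath (@exchange V)).

(** The ground D shrinks when the status of an element is decided: decided
elements stay in the members, which therefore have to agree outside D. This
avoids changing the type of the family in inductions. *)
Definition shifted D F : Prop :=
  [/\ {in F &, forall S S', #|S| = #|S'|},
      {in F &, forall S S', S :\: D = S' :\: D} &
      forall S u w, S \in F -> u \in S :&: D -> w \in D :\: S -> r w < r u ->
        swap S u w \in F].

(** T fills an initial segment of D in the order given by r. *)
Definition top D T : Prop := forall t u, t \in T :&: D -> u \in D :\: T -> r t < r u.

Definition slice F e i := [set S in F | (e \in S) == i].

Lemma in_slice F e i S : (S \in slice F e i) = (S \in F) && ((e \in S) == i).
Proof. by rewrite inE. Qed.

Lemma shifted_slice D F e i : shifted D F -> shifted (D :\ e) (slice F e i).
Proof.
case=> cF oF sF; split.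
- by move=> S S'; rewrite !in_slice => /andP[SF _] /andP[S'F _]; exact: cF.
- move=> S S'; rewrite !in_slice => /andP[SF /eqP eS] /andP[S'F /eqP eS'].
  apply/setP=> x; have /setP/(_ x) := oF _ _ SF S'F; rewrite !inE.
  by case: (x =P e) => //= ->; rewrite eS eS'.
- move=> S u w; rewrite !in_slice => /andP[SF /eqP eS] /setIP[uS].
  rewrite !inE => /andP[nue uD] /and3P[wS nwe wD] ltr.
  rewrite sF //=; rewrite ?inE ?uS ?wS //.
  by rewrite [e == w]eq_sym (negbTE nwe) [e == u]eq_sym nue eS /=.
Qed.

Lemma slice_split F e i : F = slice F e i :|: slice F e (~~ i).
Proof.
by apply/setP=> S; rewrite inE !in_slice -andb_orr; case: (e \in S) i => [] [];
  rewrite ?andbT.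
Qed.

Lemma slice_disjoint F e i : [disjoint slice F e i & slice F e (~~ i)].
Proof.
rewrite -setI_eq0; apply/eqP/setP=> S; rewrite inE !in_slice inE.
by case: (e \in S) i => [] []; rewrite ?andbF.
Qed.

Lemma shifted_ground D F S S' x : shifted D F -> S \in F -> S' \in F ->
  x \in S :\: S' -> x \in D.
Proof.
case=> _ oF _ SF S'F; rewrite inE => /andP[xS' xS].
have /setP/(_ x) := oF _ _ SF S'F; rewrite !inE xS (negbTE xS') !andbF andbT.
by move/negbFE.
Qed.

(** Trading an element outside the initial segment T for a missing element of
T is a downward trade for r, so repeated trades turn any member into T. *)
Lemma top_mem D F T S : shifted D F -> top D T -> S \in F ->
  #|T| = #|S| -> T :\: D = S :\: D -> T \in F.
Proof.
move=> shF topT; have [cF oF sF] := shF.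
move: {2}#|T :\: S| (leqnn #|T :\: S|) => n.
elim: n S => [|n IH] S leT SF cT oT.
  have /eqP : T :\: S == set0 by rewrite -cards_eq0 -leqn0.
  move/eqP; rewrite setD_eq0 => sTS.
  by have /eqP-> : T == S by rewrite eqEcard sTS cT /=.
case: (T =P S) => [-> //|/eqP nTS].
have [t tT] := setD_witness cT nTS.
have [|s sS] := setD_witness (esym cT); first by rewrite eq_sym.
move: (tT) (sS); rewrite !inE => /andP[tS' tT'] /andP[sT' sS'].
have tD : t \in D.
  by have /setP/(_ t) := oT; rewrite !inE (negbTE tS') tT' andbF andbT => /negbFE.
have sD : s \in D.
  by have /setP/(_ s) := oT; rewrite !inE (negbTE sT') sS' andbF andbT => /esym/negbFE.
have ltr : r t < r s by apply: topT; rewrite inE ?tT' ?sT' ?tD.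
have S'F : swap S s t \in F by apply: sF; rewrite ?inE ?sS' ?sD ?tS' ?tD.
apply: (IH (swap S s t)) => //; last first.
- by rewrite oT; apply: oF.
- by rewrite cT; apply: cF.
rewrite -ltnS; apply: leq_trans leT; apply: proper_card.
apply/properP; split.
  apply/subsetP=> x; rewrite !inE negb_or negb_and negbK => /andP[/andP[nxt nS] xT].
  by rewrite xT andbT; case/orP: nS => // /eqP xs; rewrite xs (negbTE sT') in xT.
by exists t => //; rewrite !inE eqxx.
Qed.

Lemma top_uniq_max D T a a' : a \in T :&: D -> a' \in T :&: D ->
    {in T :&: D, forall t, r t <= r a} -> {in T :&: D, forall t, r t <= r a'} ->
  a = a'.
Proof.
by move=> aT a'T am a'm; apply: r_inj; apply/eqP; rewrite eqn_leq am ?a'm.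
Qed.

(** In a shifted family with top T this means that the exchange graph consists
of the clique of the sets T - a + f and the clique of the sets T - u + b, both
taken together with T, that T and T - a + b are their only common vertices, and
that both are larger. So no Hamilton path joins these two vertices. *)
Definition pinched F D T a b : bool :=
  [&& a \in T :&: D, b \in D :\: T,
      [forall t in T :&: D, r t <= r a], [forall f in D :\: T, r b <= r f],
      [exists f in D :\: T, (f != b) && (swap T a f \in F)],
      [exists u in T :&: D, (u != a) && (swap T u b \in F)] &
      [forall u in T :&: D, forall f in D :\: T,
         (u != a) && (f != b) ==> (swap T u f \notin F)]].

Lemma pinchedP F D T a b : reflect
  [/\ a \in T :&: D /\ b \in D :\: T,
      {in T :&: D, forall t, r t <= r a} /\ {in D :\: T, forall f, r b <= r f},
      exists f, [/\ f \in D :\: T, f != b & swap T a f \in F],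
      exists u, [/\ u \in T :&: D, u != a & swap T u b \in F] &
      forall u f, u \in T :&: D -> f \in D :\: T -> u != a -> f != b ->
        swap T u f \notin F]
  (pinched F D T a b).
Proof.
rewrite /pinched; apply: (iffP idP) => [|[[-> ->] [am bm] [f [fD nf fF]] [u [uD nu uF]] H]].
  case/and5P=> -> -> /forall_inP am /forall_inP bm /and3P[].
  move=> /exists_inP[f fD /andP[nf fF]] /exists_inP[u uD /andP[nu uF]] /forall_inP H.
  split=> //; [by exists f|by exists u|].
  move=> u' f' u'D f'D nu' nf'; have /forall_inP/(_ f' f'D) := H u' u'D.
  by rewrite nu' nf'.
apply/and5P; split=> //; [exact/forall_inP|exact/forall_inP|apply/and3P; split].
- by apply/exists_inP; exists f; rewrite ?nf.
- by apply/exists_inP; exists u; rewrite ?nu.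
- apply/forall_inP=> u' u'D; apply/forall_inP=> f' f'D.
  by apply/implyP=> /andP[nu' nf']; apply: H.
Qed.

Lemma exchange_row T a f g : a \in T -> f \notin T -> g \notin T -> f != g ->
  exchange (swap T a f) (swap T a g).
Proof.
move=> aT fT gT nfg; rewrite -(swap_swap aT fT nfg).
by apply: exchange_swap; rewrite !in_swap ?eqxx // eq_sym (negbTE nfg) (negbTE gT) andbF.
Qed.

Lemma exchange_col T u w b : u \in T -> w \in T -> b \notin T -> u != w ->
  exchange (swap T u b) (swap T w b).
Proof.
move=> uT wT bT nuw.
have -> : swap T w b = swap (swap T u b) w u.
  apply/setP=> x; rewrite !in_swap; case: (x =P w) => [->|] /=.
    rewrite [w == u]eq_sym (negbTE nuw) !orbF.
    by apply: contraNF bT => /eqP <-.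
  by case: (x =P u) => [->|] //=; rewrite uT orbT.
apply: exchange_swap; rewrite in_swap.
  by rewrite wT [w == u]eq_sym nuw orbT.
by rewrite eqxx orbF; apply: contraNneq bT => <-.
Qed.

Lemma swap_inj_in T u w f g : u \in T -> w \in T -> f \notin T -> g \notin T ->
  swap T u f = swap T w g -> u = w /\ f = g.
Proof.
move=> uT wT fT gT E; split.
  by apply/set1P; rewrite -(swapDl wT gT) -E (swapDl uT fT) inE.
by apply/set1P; rewrite -(swapDr wT gT) -E (swapDr uT fT) inE.
Qed.

Lemma swap_neq T u f : f \notin T -> swap T u f != T.
Proof. by apply: contraNneq => <-; rewrite in_swap eqxx. Qed.

(** Among the sets that miss u and contain f, the set T - u + f is the top
one. *)
Lemma swap_mem D F T S u f : shifted D F -> top D T -> T \in F -> S \in F ->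
  u \in T :\: S -> f \in S :\: T -> swap T u f \in F.
Proof.
move=> shF topT TF SF uTS fST; have [cF oF sF] := shF.
have uD := shifted_ground shF TF SF uTS.
have fD := shifted_ground shF SF TF fST.
move: uTS fST; rewrite !inE => /andP[uS uT] /andP[fT fS].
have sh1 := shifted_slice f true shF.
have sh2 := shifted_slice u false sh1.
have topT' : top (D :\ f :\ u) (swap T u f).
  move=> t v; rewrite !inE => /and4P[tT ntu ntf tD] /and4P[vT nvu nvf vD].
  apply: topT; rewrite !inE.
    by move: tT; rewrite (negbTE ntf) ntu /= => ->.
  by move: vT; rewrite (negbTE nvf) nvu /= => ->.
have SP : S \in slice (slice F f true) u false.
  by rewrite !in_slice SF fS (negbTE uS).
have := top_mem sh2 topT' SP; rewrite card_swap // !in_slice => /(_ (cF _ _ TF SF)) H.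
suff /H/andP[/andP[]] : swap T u f :\: (D :\ f :\ u) = S :\: (D :\ f :\ u) by [].
apply/setP=> x; have /setP/(_ x) := oF _ _ TF SF; rewrite !inE.
case: (x =P f) => [->|_] /=; first by rewrite fS.
by case: (x =P u) => [->|_] //=; rewrite (negbTE uS).
Qed.

(** A member that misses some u != a of T and contains some f != b outside T
would force T - u + f into the family. *)
Lemma pinched_members D F T a b S : shifted D F -> top D T -> T \in F ->
    pinched F D T a b -> S \in F -> S != T ->
  (exists2 f, f \in D :\: T & S = swap T a f) \/
  (exists2 u, u \in T :&: D & S = swap T u b).
Proof.
move=> shF topT TF /pinchedP[[aT bD] _ _ _ H] SF nST; have [cF _ _] := shF.
have cE := cF _ _ TF SF; have cD := card_setD cE.
have DT f : f \in S :\: T -> f \in D :\: T.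
  by move=> fST; rewrite inE (shifted_ground shF SF TF fST) andbT; case/setDP: fST.
have TD u : u \in T :\: S -> u \in T :&: D.
  by move=> uTS; rewrite inE (shifted_ground shF TF SF uTS) andbT; case/setDP: uTS.
have [f fST] := setD_witness (esym cE) nST.
have [|u uTS] := setD_witness cE; first by rewrite eq_sym.
have [/exists_inP[f' f'ST nf']|] := boolP [exists f in S :\: T, f != b].
  left; have TS : T :\: S = [set a].
    apply/eqP; rewrite eqEsubset; suff sTS : T :\: S \subset [set a].
      by rewrite sTS sub1set; move: (subsetP sTS u uTS); rewrite inE => /eqP <-.
    apply/subsetP=> w wTS; rewrite inE; apply: contraT => nwa.
    by have := H w f' (TD w wTS) (DT f' f'ST) nwa nf'; rewrite (swap_mem shF topT TF SF).
  have /cards1P[g ST] : #|S :\: T| == 1 by rewrite -cD TS cards1.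
  by exists g; [apply: DT; rewrite ST inE|apply: swap_of_setD].
rewrite negb_exists_in => /forall_inP H'; right.
have ST : S :\: T = [set b].
  apply/eqP; rewrite eqEsubset; suff sST : S :\: T \subset [set b].
    by rewrite sST sub1set; move: (subsetP sST f fST); rewrite inE => /eqP <-.
  by apply/subsetP=> w wST; rewrite inE; have := H' w wST; rewrite negbK.
have /cards1P[g TS] : #|T :\: S| == 1 by rewrite cD ST cards1.
by exists g; [apply: TD; rewrite TS inE|apply: swap_of_setD].
Qed.

(** Start at T - a + b, traverse the clique that does not contain S, pass
through T and traverse the other clique up to S. *)
Lemma pinched_hpath D F T a b S : shifted D F -> top D T -> T \in F ->
    pinched F D T a b -> S \in F -> S != T -> S != swap T a b ->
  hp F (swap T a b) S.
Proof.
move=> shF topT TF rc SF nST nSab.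
have mem := pinched_members shF topT TF rc.
have /pinchedP[[aTD bDT] [am bm] [f [fDT nfb fF]] [u [uTD nua uF]] _] := rc.
have [cF oF sF] := shF.
move: (aTD) (bDT) (fDT) (uTD); rewrite !inE.
move=> /andP[aT aD] /andP[bT bD] /andP[fT fD] /andP[uT uD].
have abF : swap T a b \in F.
  rewrite -(swap_swap aT fT nfb); apply: sF; rewrite ?inE ?eqxx ?fD //=.
    by rewrite (negbTE bT) bD andbF orbF eq_sym nfb.
  by rewrite ltn_neqAle bm // andbT (inj_eq r_inj) eq_sym.
have nab : a != b by apply: contraNneq bT => <-.
have [[w wTD [ES nwa]]|[g gDT ES]] :
    (exists2 w, w \in T :&: D & S = swap T w b /\ w != a) \/
    (exists2 g, g \in D :\: T & S = swap T a g).
- have [[g gD E]|[w wT E]] := mem S SF nST; first by right; exists g.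
  by left; exists w => //; split=> //; apply: contraNneq nSab => <-; rewrite E.
- rewrite (slice_split F a false).
  have X1 : hp (slice F a false) (swap T a b) (swap T a f).
    apply: hpath_clique.
    + move=> A B; rewrite !in_slice => /andP[AF /eqP aA] /andP[BF /eqP aB].
      have row Z : Z \in F -> a \in Z = false -> exists2 g, g \in D :\: T & Z = swap T a g.
        move=> ZF aZ; have nZT : Z != T by apply: contraFneq aZ => ->.
        have [//|[v vT EZ]] := mem Z ZF nZT.
        exists b => //; rewrite EZ; congr swap; apply/eqP.
        by move: aZ; rewrite EZ in_swap (negbTE nab) aT andbT /= eq_sym => /negbFE.
      have [g1 g1D EA] := row A AF aA; have [g2 g2D EB] := row B BF aB.
      rewrite EA EB => nAB; move: g1D g2D; rewrite !inE => /andP[? _] /andP[? _].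
      by apply: exchange_row => //; apply: contraNneq nAB => ->.
    + by rewrite in_slice abF in_swap (negbTE nab) eqxx.
    + rewrite in_slice fF in_swap eqxx orbF.
      by apply/eqP; apply: contraNF fT => /eqP <-.
    + apply/eqP=> /(swap_inj_in aT aT bT fT)[_ Ebf].
      by rewrite Ebf eqxx in nfb.
  have X2 : hp (slice F a true) T S.
    apply: hpath_clique; last by rewrite eq_sym.
    + have col Z : Z \in F -> a \in Z -> Z != T -> exists2 v, v \in T :&: D & Z = swap T v b.
        move=> ZF aZ nZT; have [[g gD EZ]|//] := mem Z ZF nZT.
        exfalso; move: aZ; rewrite EZ in_swap eqxx orbF.
        by move=> Eag; move: gD; rewrite inE -(eqP Eag) aT.
      move=> A B; rewrite !in_slice !eqb_id => /andP[AF aA] /andP[BF aB] nAB.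
      have [EA|nAT] := eqVneq A T.
        have nBT : B != T by rewrite -EA eq_sym.
        have [v vT ->] := col B BF aB nBT; rewrite EA.
        by apply: exchange_swap => //; case/setIP: vT.
      have [v vT EA] := col A AF aA nAT.
      have [EB|nBT] := eqVneq B T.
        by rewrite EB EA exchange_sym; apply: exchange_swap => //; case/setIP: vT.
      have [v' v'T EB] := col B BF aB nBT; rewrite EA EB.
      case/setIP: vT => vT _; case/setIP: v'T => v'T _.
      by apply: exchange_col => //; apply: contraNneq nAB => Ev; rewrite EA EB Ev.
    + by rewrite in_slice TF aT.
    + by rewrite in_slice SF ES in_swap (negbTE nab) [a == w]eq_sym nwa aT.
  apply: (hpath_cat X1 _ X2); first by rewrite exchange_sym; apply: exchange_swap.
  exact: slice_disjoint.
have ngb : g != b by apply: contraNneq nSab => <-; rewrite ES.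
move: (gDT); rewrite inE => /andP[gT gD].
rewrite (slice_split F b true).
have X1 : hp (slice F b true) (swap T a b) (swap T u b).
  apply: hpath_clique.
  + move=> A B; rewrite !in_slice !eqb_id => /andP[AF bA] /andP[BF bB].
    have col Z : Z \in F -> b \in Z -> exists2 v, v \in T :&: D & Z = swap T v b.
      move=> ZF bZ; have nZT : Z != T by apply: contraTneq bZ => ->.
      have [[h hD EZ]|//] := mem Z ZF nZT.
      exists a => //; rewrite EZ; congr swap; apply/eqP.
      by move: bZ; rewrite EZ in_swap (negbTE bT) andbF orbF eq_sym.
    have [v vT EA] := col A AF bA; have [v' v'T EB] := col B BF bB.
    case/setIP: vT => vT _; case/setIP: v'T => v'T _.
    rewrite EA EB => nAB; apply: exchange_col => //.
    by apply: contraNneq nAB => ->.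
  + by rewrite in_slice abF in_swap eqxx.
  + by rewrite in_slice uF in_swap eqxx.
  + by apply/eqP=> /(swap_inj_in aT uT bT bT)[Eau _]; rewrite Eau eqxx in nua.
have X2 : hp (slice F b false) T S.
  apply: hpath_clique; last by rewrite eq_sym.
  + have row Z : Z \in F -> b \in Z = false -> Z != T -> exists2 h, h \in D :\: T & Z = swap T a h.
      move=> ZF bZ nZT; have [//|[v vT EZ]] := mem Z ZF nZT.
      by move: bZ; rewrite EZ in_swap eqxx.
    move=> A B; rewrite !in_slice => /andP[AF /eqP bA] /andP[BF /eqP bB] nAB.
    have [EA|nAT] := eqVneq A T.
      have nBT : B != T by rewrite -EA eq_sym.
      have [h hD ->] := row B BF bB nBT; rewrite EA.
      by apply: exchange_swap => //; case/setDP: hD.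
    have [h hD EA] := row A AF bA nAT.
    have [EB|nBT] := eqVneq B T.
      by rewrite EB EA exchange_sym; apply: exchange_swap => //; case/setDP: hD.
    have [h' h'D EB] := row B BF bB nBT; rewrite EA EB.
    case/setDP: hD => _ hT; case/setDP: h'D => _ h'T.
    by apply: exchange_row => //; apply: contraNneq nAB => Ev; rewrite EA EB Ev.
  + by rewrite in_slice TF (negbTE bT).
  + rewrite in_slice SF ES in_swap (negbTE bT) andbF orbF.
    by rewrite [b == g]eq_sym (negbTE ngb).
apply: (hpath_cat X1 _ X2); first by rewrite exchange_sym; apply: exchange_swap.
exact: slice_disjoint.
Qed.

(** A member whose elements have the least sum of ranks admits no further
trade. *)
Lemma top_exists D F S : shifted D F -> S \in F -> exists2 T, T \in F & top D T.
Proof.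
move=> [_ _ sF] SF.
case: (arg_minnP (fun T : {set V} => \sum_(x in T) r x) SF) => T TF minT.
exists T => // t u tTD uDT; rewrite ltnNge; apply/negP => le_ut.
have nut : u != t.
  by apply: contraTneq uDT => ->; rewrite inE; case/setIP: tTD => ->.
have ltut : r u < r t by rewrite ltn_neqAle le_ut andbT (inj_eq r_inj).
have := minT _ (sF _ _ _ TF tTD uDT ltut).
case/setIP: tTD => tT _; case/setDP: uDT => _ uT.
rewrite /swap big_setU1 ?inE ?(negbTE uT) ?andbF //= (big_setD1 t tT) /=.
by rewrite leq_add2r leqNgt ltut.
Qed.

Lemma topD1 D T e : top D T -> top (D :\ e) T.
Proof.
move=> topT t u; rewrite !inE => /and3P[tT _ tD] /and3P[uT _ uD].
by apply: topT; rewrite inE ?tT ?uT.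
Qed.

Definition exceptional F D T S :=
  [exists a, exists b, pinched F D T a b && (S == swap T a b)].

Lemma exceptionalP F D T S :
  reflect (exists a b, pinched F D T a b /\ S = swap T a b) (exceptional F D T S).
Proof.
apply: (iffP existsP) => [[a /existsP[b /andP[rc /eqP E]]]|[a [b [rc E]]]].
  by exists a, b.
by exists a; apply/existsP; exists b; rewrite rc E eqxx.
Qed.

Definition paths_upto n := forall D F S, #|D| <= n -> shifted D F -> S \in F ->
  exists S', hp F S S'.

Definition top_paths_upto n := forall D F T S, #|D| <= n -> shifted D F -> top D T ->
  T \in F -> S \in F -> S != T -> ~~ exceptional F D T S -> hp F S T.

Section Step.
Variables (n : nat) (D : {set V}) (F : {set {set V}}) (T : {set V}).
Hypotheses (IHP : paths_upto n) (IHT : top_paths_upto n).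
Hypotheses (cardD : #|D| <= n.+1) (shF : shifted D F) (topT : top D T) (TF : T \in F).

Section Split.
Variable e : V.
Hypothesis eDT : e \in D :\: T.

Let cardDe : #|D :\ e| <= n.
Proof. by case/setDP: eDT => eD _; move: cardD; rewrite (cardsD1 e D) eD. Qed.

Let TZ0 : T \in slice F e false.
Proof. by rewrite in_slice TF; case/setDP: eDT => _ /negbTE->. Qed.

(** A member X that contains an element e outside T misses some u of T, and u
precedes e; so no matter where a path through the members with e stops, it can
continue to the members without e. *)
Lemma exitT X u : X \in slice F e true -> u \in T :\: X ->
  swap X e u \in slice F e false /\ exchange X (swap X e u).
Proof.
rewrite in_slice eqb_id => /andP[XF eX] uTX; have [_ _ sF] := shF.
have uD := shifted_ground shF TF XF uTX.
case/setDP: uTX => uT uX; case/setDP: eDT => eD eT.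
split; last exact: exchange_swap.
have nue : u != e by apply: contraNneq eT => <-.
rewrite in_slice in_swap eqxx orbF [e == u]eq_sym (negbTE nue) /= andbT.
by apply: sF; rewrite ?inE ?eX ?uX //; apply: topT; rewrite inE ?uT ?eT.
Qed.

(** The common scheme: traverse the members that contain e from S to X, step to
Y, and apply the induction hypothesis for the path from Y to T among the
members that avoid e. The next lemmas find a suitable Y for different X. *)
Lemma split_finish S X Y :
    hp (slice F e true) S X -> Y \in slice F e false -> exchange X Y -> Y != T ->
    ~~ exceptional (slice F e false) (D :\ e) T Y ->
  hp F S T.
Proof.
move=> SX YZ XY nYT nex; rewrite (slice_split F e true).
apply: (hpath_cat SX XY); last exact: slice_disjoint.
by apply: (IHT cardDe) nex => //; [apply: shifted_slice|apply: topD1].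
Qed.

Lemma split_trivial S : S \in slice F e true -> slice F e false = [set T] -> hp F S T.
Proof.
move=> SZ Z0E; have [X SX] := IHP cardDe (shifted_slice e true shF) SZ.
have XZ := hpath_end SX.
have nTX : T != X.
  apply: contraTneq XZ => <-; rewrite in_slice eqb_id negb_and.
  by case/setDP: eDT => _ ->; rewrite orbT.
have [cF _ _] := shF; have XF : X \in F by move: XZ; rewrite in_slice => /andP[].
have [u uTX] := setD_witness (cF _ _ TF XF) nTX.
have [YZ XY] := exitT XZ uTX; move: (YZ); rewrite Z0E => /set1P YT.
rewrite YT in XY; rewrite (slice_split F e true) /= Z0E.
apply: (hpath_cat SX XY); first exact: hpath1.
by have := slice_disjoint F e true; rewrite /= Z0E.
Qed.

Variable a : V.
Hypotheses (aTD : a \in T :&: D) (amax : {in T :&: D, forall t, r t <= r a}).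

Lemma pinched_split_max a' b' : pinched (slice F e false) (D :\ e) T a' b' -> a' = a.
Proof.
case/pinchedP=> -[aT' _] [am' _] _ _ _.
move: aT'; rewrite !inE => /and3P[a'T nae a'D].
apply: (top_uniq_max (D := D) (T := T)) => //; first by rewrite inE a'T.
move=> t /setIP[tT tD]; apply: am'; rewrite !inE tT tD andbT /=.
by case/setDP: eDT => _; apply: contraNneq => <-.
Qed.

(** Restoring one of two missing elements of T cannot yield T, and if the
largest element a of T is present afterwards, Y is not the exceptional set. *)
Lemma split_two_missing S X u1 u2 : hp (slice F e true) S X ->
  u1 \in T :\: X -> u2 \in T :\: X -> u1 != u2 -> hp F S T.
Proof.
move=> SX u1X u2X n12; have XZ := hpath_end SX.
have gen u u' : u \in T :\: X -> u' \in T :\: X -> u != u' -> (a \in X) || (u == a) -> hp F S T.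
  move=> uX u'X nuu' aXu; have [YZ XY] := exitT XZ uX.
  apply: split_finish SX YZ XY _ _.
    case/setDP: u'X => u'T u'X; apply: contraTneq u'T => <-.
    by rewrite in_swap [u' == u]eq_sym (negbTE nuu') (negbTE u'X) andbF.
  apply/exceptionalP=> -[a' [b' [rc E]]]; have Ea := pinched_split_max rc; subst a'.
  have /pinchedP[[_]] := rc; rewrite !inE => /and3P[b'T _ _] _ _ _ _.
  case/setIP: (aTD) => aT aD.
  have : a \in swap X e u.
    rewrite in_swap; case/orP: aXu => [->|/eqP->]; last by rewrite eqxx.
    by rewrite andbT; apply/orP; right; case/setDP: eDT => _; apply: contraNneq => <-.
  rewrite E in_swap eqxx orbF => /eqP Eab; by rewrite -Eab aT in b'T.
have [aX|aX] := boolP (a \in X); first by apply: (gen u1 u2); rewrite ?aX.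
have aTX : a \in T :\: X by rewrite inE aX; case/setIP: aTD.
have [Ea|na] := eqVneq u1 a; first by apply: (gen u1 u2); rewrite ?Ea ?eqxx ?orbT // -Ea.
by apply: (gen a u1); rewrite ?eqxx ?orbT // eq_sym.
Qed.

Lemma split_lower_swap S u f : hp (slice F e true) S (swap T u e) ->
  u \in T :&: D -> u != a ->
  f \in D :\: T -> f != e -> swap T u f \in F -> hp F S T.
Proof.
move=> SX uTD nua fDT nfe YF.
case/setIP: uTD => uT uD; case/setDP: fDT => fD fT; case/setDP: (eDT) => eD eT.
apply: (split_finish (Y := swap T u f)) SX _ _ _ _ => //.
- by rewrite in_slice YF in_swap [e == f]eq_sym (negbTE nfe) (negbTE eT) andbF.
- by apply: exchange_row => //; rewrite eq_sym.
- exact: swap_neq.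
apply/exceptionalP=> -[a' [b' [rc E]]]; have Ea := pinched_split_max rc; subst a'.
have /pinchedP[[_]] := rc; rewrite !inE => /and3P[b'T _ _] _ _ _ _.
case/setIP: (aTD) => aT aD.
by have [Eua _] := swap_inj_in uT aT fT b'T E; rewrite Eua eqxx in nua.
Qed.

Lemma row_in_split X : X \in slice F e false -> X != T ->
  exists f, [/\ f \in D :\: T, f != e & swap T a f \in F].
Proof.
rewrite in_slice => /andP[XF /eqP eX] nXT; have [cF _ sF] := shF.
have [f fX] := setD_witness (cF _ _ XF TF) nXT.
have [|u uX] := setD_witness (cF _ _ TF XF); first by rewrite eq_sym.
have Y := swap_mem shF topT TF XF uX fX.
have fD := shifted_ground shF XF TF fX; have uD := shifted_ground shF TF XF uX.
case/setDP: fX => fXX fT; case/setDP: uX => uT uX.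
exists f; split; first by rewrite inE fT.
  by apply: contraTneq fXX => ->; rewrite eX.
have [<- //|nua] := eqVneq u a.
case/setIP: (aTD) => aT aD.
have nuf : u != f by apply: contraNneq fT => <-.
have -> : swap T a f = swap (swap T u f) a u.
  apply/setP=> x; rewrite !in_swap; case: (x =P u) => [->|] /=.
    by rewrite nua uT orbT.
  by case: (x =P f) => [->|] //= _; case: eqP => // Efa; rewrite Efa aT in fT.
apply: sF => //; rewrite ?inE.
- by rewrite [a == u]eq_sym nua aT aD orbT.
- by rewrite uD (negbTE nuf) eqxx.
- by rewrite ltn_neqAle (inj_eq r_inj) nua amax // inE uT.
Qed.

(** The exceptional set is one particular T - a + f; when it is hit, the
pinched family of the members without e offers another set of this form. *)
Lemma split_max_swap S X : hp (slice F e true) S (swap T a e) ->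
  X \in slice F e false -> X != T -> hp F S T.
Proof.
move=> SX XZ nXT; have [f [fDT nfe fF]] := row_in_split XZ nXT.
case/setIP: (aTD) => aT aD; case/setDP: (eDT) => eD eT.
have key g : g \in D :\: T -> g != e -> swap T a g \in F ->
    ~~ exceptional (slice F e false) (D :\ e) T (swap T a g) -> hp F S T.
  case/setDP=> gD gT nge gF; apply: (split_finish (Y := swap T a g)) SX _ _ _ => //.
  - by rewrite in_slice gF in_swap [e == g]eq_sym (negbTE nge) (negbTE eT) andbF.
  - by apply: exchange_row => //; rewrite eq_sym.
  - exact: swap_neq.
have [/exceptionalP[a' [b' [rc E]]]|] :=
    boolP (exceptional (slice F e false) (D :\ e) T (swap T a f)); last exact: key.
have Ea := pinched_split_max rc; subst a'.
have /pinchedP[[_ b'D] [_ bm] [g [gD ngb gF]] _ _] := rc.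
move: gD gF; rewrite in_slice !inE => /and3P[gT nge gD] /andP[gF _].
apply: (key g) => //; first by rewrite inE gT.
apply/exceptionalP=> -[a'' [b'' [rc' E']]]; have Ea := pinched_split_max rc'; subst a''.
have /pinchedP[[_ b''D] [_ bm'] _ _ _] := rc'.
have Ebb : b' = b'' by apply: r_inj; apply/eqP; rewrite eqn_leq bm // bm'.
move: b''D; rewrite !inE => /and3P[b''T _ _].
by have [_ Eg] := swap_inj_in aT aT gT b''T E'; rewrite Eg Ebb eqxx in ngb.
Qed.

End Split.

End Step.

Lemma max_exists (A : {set V}) x : x \in A ->
  exists2 a, a \in A & {in A, forall t, r t <= r a}.
Proof. by move=> xA; case: (arg_maxnP r xA) => a aA am; exists a. Qed.

Lemma min_exists (A : {set V}) x : x \in A ->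
  exists2 a, a \in A & {in A, forall t, r a <= r t}.
Proof. by move=> xA; case: (arg_minnP r xA) => a aA am; exists a. Qed.

Lemma top_swap D T a b : top D T -> a \in T :&: D -> b \in D :\: T ->
    {in T :&: D, forall t, r t <= r a} ->
  top (D :\ b) (swap T a b).
Proof.
move=> topT aTD bDT am t u; rewrite !inE => /and3P[tT ntb tD] /and3P[uT nub uD].
move: tT uT; rewrite (negbTE ntb) (negbTE nub) /= negb_and negbK => /andP[nta tT].
have tTD : t \in T :&: D by rewrite inE tT.
case/orP=> [/eqP-> |uT]; last by apply: topT; rewrite // inE uT.
by rewrite ltn_neqAle (inj_eq r_inj) nta am.
Qed.

(** Split by an element e of S outside T, if possible by one other than the
least element b outside T: then any path through the members with e will do.
If S :\: T is {b}, the members with b have top T1 = T - a + b. A path from S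
through them should avoid stopping at a set T - u + b for which no T - u + f
with f != b is a member. It can stop at T1. If S is T1 and not the only member
with b, or if the induction hypothesis excludes T1, it can stop at a set that
misses two elements of T or at some T - u + b that is good because F is not
pinched. *)
Lemma shifted_step n : paths_upto n -> top_paths_upto n -> top_paths_upto n.+1.
Proof.
move=> IHP IHT D F T S cardD shF topT TF SF nST nex; have [cF oF sF] := shF.
have [e0 e0ST] := setD_witness (cF _ _ SF TF) nST.
have [|s0 s0TS] := setD_witness (cF _ _ TF SF); first by rewrite eq_sym.
have e0DT : e0 \in D :\: T.
  by rewrite inE (shifted_ground shF SF TF e0ST) andbT; case/setDP: e0ST.
have s0TD : s0 \in T :&: D.
  by rewrite inE (shifted_ground shF TF SF s0TS) andbT; case/setDP: s0TS.
have [a aTD am] := max_exists s0TD; have [b bDT bm] := min_exists e0DT.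
case/setIP: (aTD) => aT aD; case/setDP: (bDT) => bD bT.
have nab : a != b by apply: contraNneq bT => <-.
have trivial_or e : e \in D :\: T -> e \in S -> hp F S T \/
    exists2 X, X \in slice F e false & X != T.
  move=> eDT eS; have [/eqP Z0E|] := boolP (slice F e false == [set T]).
    left; apply: (split_trivial IHP cardD shF topT TF eDT) => //.
    by rewrite in_slice SF eS.
  rewrite eqEsubset sub1set in_slice TF; case/setDP: (eDT) => _ /negbTE->.
  by rewrite andbT => /subsetPn[X XZ]; rewrite inE => nXT; right; exists X.
have DTof X e : X \in F -> e \in X :\: T -> e \in D :\: T.
  by move=> XF eX; rewrite inE (shifted_ground shF XF TF eX) andbT; case/setDP: eX.
have TDof X u : X \in F -> u \in T :\: X -> u \in T :&: D.
  by move=> XF eX; rewrite inE (shifted_ground shF TF XF eX) andbT; case/setDP: eX.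
have shape X e : X \in F -> e \in X -> e \in D :\: T ->
    (exists u1 u2, [/\ u1 \in T :\: X, u2 \in T :\: X & u1 != u2]) \/
    (exists2 u, u \in T :&: D & X = swap T u e).
  move=> XF eX eDT; have nXT : X != T.
    by apply: contraTneq eX => ->; case/setDP: eDT.
  have [|u uX] := setD_witness (cF _ _ TF XF); first by rewrite eq_sym.
  have [E|] := eqVneq (T :\: X) [set u].
    right; exists u; first exact: TDof uX.
    apply: (swap_of_setD E); apply/eqP; rewrite eq_sym eqEcard sub1set inE eX.
    case/setDP: eDT => _ ->; rewrite /= -(card_setD (cF _ _ TF XF)) E !cards1.
    by [].
  rewrite eqEsubset sub1set uX andbT => /subsetPn[u' u'X]; rewrite inE => nu.
  by left; exists u', u.
have low u f : u \in T :&: D -> f \in D :\: T -> f != b -> swap T u f \in F -> swap T u b \in F.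
  case/setIP=> uT uD /setDP[fD fT] neb XF; rewrite -(swap_swap uT fT neb).
  apply: sF; rewrite ?inE ?eqxx ?fD //.
    by rewrite (negbTE bT) bD andbF orbF [b == f]eq_sym neb.
  by rewrite ltn_neqAle (inj_eq r_inj) eq_sym neb bm // inE fT.
have [/exists_inP[e eST neb]|] := boolP [exists e in S :\: T, e != b].
  have eDT := DTof S e SF eST; case/setDP: (eST) => eS eT.
  have SZ : S \in slice F e true by rewrite in_slice SF eS.
  have cDe : #|D :\ e| <= n.
    by case/setDP: (eDT) => eD _; move: cardD; rewrite (cardsD1 e D) eD.
  have [//|[Y YZ nYT]] := trivial_or e eDT eS.
  have [X SX] := IHP _ _ _ cDe (shifted_slice e true shF) SZ.
  have := hpath_end SX; rewrite in_slice eqb_id => /andP[XF eX].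
  have [[u1 [u2 [u1X u2X nu]]]|[u uTD EX]] := shape X e XF eX eDT.
    exact: (split_two_missing IHT cardD shF topT TF eDT aTD am SX u1X u2X nu).
  have [Ea|nua] := eqVneq u a.
    rewrite EX Ea in SX.
    exact: (split_max_swap IHT cardD shF topT TF eDT aTD am SX YZ nYT).
  rewrite EX in SX; apply: (split_lower_swap IHT cardD shF topT TF eDT aTD am SX uTD nua bDT).
    by rewrite eq_sym.
  by apply: (low u e) => //; rewrite -EX.
rewrite negb_exists_in => /forall_inP onlyb.
have Eb : e0 = b by have := onlyb e0 e0ST; rewrite negbK => /eqP.
have bS : b \in S by rewrite -Eb; case/setDP: e0ST.
have [//|[Y YZ nYT]] := trivial_or b bDT bS.
have shZ1 := shifted_slice b true shF.
have SZ : S \in slice F b true by rewrite in_slice SF bS.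
have cDb : #|D :\ b| <= n by move: cardD; rewrite (cardsD1 b D) bD.
set T1 := swap T a b.
have topT1 : top (D :\ b) T1 by exact: top_swap.
have [s sTD ES] : exists2 s, s \in T :&: D & S = swap T s b.
  have [[u1 [u2 [u1S u2S nu]]]|//] := shape S b SF bS bDT.
  have : #|S :\: T| <= #|[set b]|.
    by apply/subset_leq_card/subsetP=> x xS; rewrite inE; have := onlyb x xS; rewrite negbK.
  rewrite cards1 -(card_setD (cF _ _ TF SF)) => /card_le1P/(_ u1 u1S)/(_ u2).
  by rewrite u2S !inE eq_sym (negbTE nu).
case/setIP: (sTD) => sT sD.
have T1Z : T1 \in slice F b true.
  rewrite in_slice in_swap eqxx eqb_id andbT.
  have [Esa|nsa] := eqVneq s a; first by rewrite /T1 -Esa -ES.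
  have nsb : s != b by apply: contraNneq bT => <-.
  have -> : T1 = swap S a s.
    rewrite ES; apply/setP=> x; rewrite !in_swap; case: (x =P s) => [->|] /=.
      by rewrite nsa sT orbT.
    by case: (x =P b) => [->|] //= _; rewrite eq_sym nab.
  apply: sF => //; rewrite ?ES ?inE.
  - by rewrite [a == s]eq_sym nsa aT aD orbT.
  - by rewrite (negbTE nsb) eqxx sD.
  - by rewrite ltn_neqAle (inj_eq r_inj) nsa am.
(* The third set offered by a pinched family of members with b misses both a
   and a1. *)
have row_good a1 b1 f : a1 \in T1 :&: (D :\ b) -> f \in (D :\ b) :\: T1 ->
   f != b1 -> pinched (slice F b true) (D :\ b) T1 a1 b1 ->
   hp (slice F b true) S (swap T1 a1 f) -> hp F S T.
  move=> a1T1 fT1 nf rc SX.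
  have fa : f != a.
    apply: contraNneq nf => ->; have /pinchedP[[_ b1D] [_ b1m] _ _ _] := rc.
    have aD1 : a \in D :\ b :\: T1.
      by rewrite !inE (negbTE nab) eqxx /= aD.
    apply/eqP/r_inj/eqP; rewrite eqn_leq b1m // andbT.
    move: b1D; rewrite !inE => /and3P[b1T nb1 b1D].
    move: b1T; rewrite (negbTE nb1) /= negb_and negbK.
    case/orP=> [/eqP-> //|b1T]; apply: ltnW; apply: topT => //.
    by rewrite inE b1T.
  move: (a1T1) (fT1); rewrite !inE => /and3P[a1T na1b a1D] /and3P[fT nfb fD].
  move: a1T fT; rewrite (negbTE na1b) (negbTE nfb) (negbTE fa) /= => /andP[na1 a1T] fT.
  apply: (split_two_missing IHT cardD shF topT TF bDT aTD am SX (u1 := a) (u2 := a1)) => //;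
    last by rewrite eq_sym.
    by rewrite !inE [a == f]eq_sym (negbTE fa) (negbTE nab) eqxx !andbF aT.
  rewrite !inE eqxx /= orbF a1T andbT.
  by apply: contraNneq fT => <-.
have to_T1 X : X \in slice F b true -> X != T1 ->
    ~~ exceptional (slice F b true) (D :\ b) T1 X ->
    hp (slice F b true) X T1.
  by move=> XZ nX nexX; apply: (IHT _ _ _ _ cDb shZ1 topT1 T1Z XZ nX nexX).
have [EST1|nST1] := eqVneq S T1; last first.
  have [/exceptionalP[a1 [b1 [rc ES1]]]|nexZ] :=
      boolP (exceptional (slice F b true) (D :\ b) T1 S); last first.
    exact: (split_max_swap IHT cardD shF topT TF bDT aTD am (to_T1 S SZ nST1 nexZ) YZ nYT).
  have /pinchedP[[a1D b1D] _ [f [fD nf fZ]] _ _] := rc.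
  apply: (row_good a1 b1 f) => //; rewrite ES1.
  case/setIP: (a1D) => a1T _; case/setDP: (fD) => _ fT; case/setDP: (b1D) => _ b1T.
  apply: (pinched_hpath shZ1 topT1 T1Z rc fZ); first exact: swap_neq.
  by apply/eqP=> /(swap_inj_in a1T a1T fT b1T)[_ Ef]; rewrite Ef eqxx in nf.
have back X : X \in slice F b true -> X != T1 ->
    ~~ exceptional (slice F b true) (D :\ b) T1 X ->
    hp (slice F b true) S X.
  by move=> XZ nX nexX; rewrite EST1; apply: hpath_rev (@exchange_sym V) (to_T1 X XZ nX nexX).
have [/existsP[a1 /existsP[b1 rc]]|norc] :=
    boolP [exists a1, exists b1, pinched (slice F b true) (D :\ b) T1 a1 b1].
  have /pinchedP[[a1D b1D] [_ b1m] [f [fD nf fZ]] _ _] := rc.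
  case/setIP: (a1D) => a1T _; case/setDP: (fD) => _ fT.
  apply: (row_good a1 b1 f) => //; apply: back => //; first exact: swap_neq.
  apply/exceptionalP=> -[a2 [b2 [rc2 E]]].
  have /pinchedP[[a2D b2D] [_ b2m] _ _ _] := rc2.
  case/setIP: (a2D) => a2T _; case/setDP: (b2D) => _ b2T.
  have [_ Ef] := swap_inj_in a1T a2T fT b2T E.
  have Eb12 : b1 = b2 by apply: r_inj; apply/eqP; rewrite eqn_leq b1m // b2m.
  by rewrite Ef Eb12 eqxx in nf.
have nexc X : ~~ exceptional (slice F b true) (D :\ b) T1 X.
  apply: contra norc => /exceptionalP[a1 [b1 [rc _]]].
  by apply/existsP; exists a1; apply/existsP; exists b1.
have [[X0 X0Z nX0]|Z1E] :
    (exists2 X, X \in slice F b true & X != T1) \/ slice F b true = [set T1].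
- have [/eqP|] := boolP (slice F b true == [set T1]); first by right.
  rewrite eqEsubset sub1set T1Z andbT => /subsetPn[X XZ]; rewrite inE => nX.
  by left; exists X.
- have := X0Z; rewrite in_slice eqb_id => /andP[X0F bX0].
  have [[u1 [u2 [u1X u2X nu]]]|[u0 u0TD EX0]] := shape X0 b X0F bX0 bDT.
    exact: (split_two_missing IHT cardD shF topT TF bDT aTD am
      (back _ X0Z nX0 (nexc X0)) u1X u2X nu).
  have [f [fDT nf fF]] := row_in_split shF topT TF aTD am YZ nYT.
  have nrc : ~~ pinched F D T a b.
    apply: contra nex => rc; apply/exceptionalP; exists a, b; split=> //.
  have nu0 : u0 != a by apply: contraNneq nX0 => Eu; rewrite EX0 Eu.
  have [u [f' [uTD f'DT nua nf'b YF]]] :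
      exists u f', [/\ u \in T :&: D, f' \in D :\: T, u != a, f' != b & swap T u f' \in F].
    have [/exists_inP[u uTD /exists_inP[f' f'D /and3P[? ? ?]]]|H] :=
      boolP [exists u in T :&: D, exists f' in D :\: T,
        [&& u != a, f' != b & swap T u f' \in F]].
      by exists u, f'.
    case/negP: nrc; apply/pinchedP; split=> //; first by exists f.
      by exists u0; rewrite -EX0.
    move=> u f' uTD f'DT nu nf'; apply: contra H => YF.
    by apply/exists_inP; exists u => //; apply/exists_inP; exists f'; rewrite ?nu ?nf'.
  case/setIP: (uTD) => uT uD.
  have XZ : swap T u b \in slice F b true.
    by rewrite in_slice in_swap eqxx (low u f').
  have nXT1 : swap T u b != T1.
    by apply/eqP=> /(swap_inj_in uT aT bT bT)[Eu _]; rewrite Eu eqxx in nua.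
  exact: (split_lower_swap IHT cardD shF topT TF bDT aTD am
    (back _ XZ nXT1 (nexc _)) uTD nua f'DT nf'b YF).
apply: (split_max_swap IHT cardD shF topT TF bDT aTD am _ YZ nYT).
by rewrite -/T1 EST1 Z1E; apply: hpath1.
Qed.

(** A pinched family has a third set T - a + f besides T and the exceptional
one. *)
Lemma not_exceptional_exists D F T X : X \in F -> X != T ->
  exists Y, [/\ Y \in F, Y != T & ~~ exceptional F D T Y].
Proof.
move=> XF nXT; have [/exceptionalP[a [b [rc _]]]|] := boolP (exceptional F D T X);
  last by exists X.
have /pinchedP[[aTD bDT] [_ bm] [f [fDT nf fF]] _ _] := rc.
case/setIP: (aTD) => aT _; case/setDP: (fDT) => _ fT; case/setDP: (bDT) => _ bT.
exists (swap T a f); split=> //; first exact: swap_neq.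
apply/exceptionalP=> -[a' [b' [rc' E]]].
have /pinchedP[[a'TD b'DT] [_ b'm] _ _ _] := rc'.
case/setIP: (a'TD) => a'T _; case/setDP: (b'DT) => _ b'T.
have [_ Ef] := swap_inj_in aT a'T fT b'T E.
have Eb : b = b' by apply: r_inj; apply/eqP; rewrite eqn_leq bm // b'm.
by rewrite Ef Eb eqxx in nf.
Qed.

(** A path from S != T splits by an element of S outside T, by [exitT]; a path
from T is the reversal of a path that ends there. *)
Lemma shifted_hpaths n : paths_upto n /\ top_paths_upto n.
Proof.
elim: n => [|n [IHP IHT]].
  have single D F S S' : #|D| <= 0 -> shifted D F -> S \in F -> S' \in F -> S = S'.
    rewrite leqn0 cards_eq0 => /eqP-> [_ oF _] SF S'F.
    by have := oF _ _ SF S'F; rewrite !setD0.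
  split=> [D F S D0 shF SF|D F T S D0 shF _ TF SF]; last first.
    by rewrite (single D F T S) ?eqxx.
  exists S; have -> : F = [set S]; last exact: hpath1.
  apply/setP=> X; rewrite inE; apply/idP/eqP=> [XF|-> //].
  exact: single D0 shF XF SF.
have IHT' := shifted_step IHP IHT; split=> // D F S cardD shF SF.
have [T TF topT] := top_exists shF SF; have [cF _ _] := shF.
have [ES|nST] := eqVneq S T.
  have [/eqP->|] := boolP (F == [set S]); first by exists S; apply: hpath1.
  rewrite eqEsubset sub1set SF andbT => /subsetPn[X XF]; rewrite inE => nXS.
  have nXT : X != T by rewrite -ES.
  have [Y [YF nYT nex]] := not_exceptional_exists D XF nXT.
  exists Y; rewrite ES; apply: hpath_rev (@exchange_sym V) _.
  exact: (IHT' D).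
have [e eST] := setD_witness (cF _ _ SF TF) nST.
have eDT : e \in D :\: T.
  by rewrite inE (shifted_ground shF SF TF eST) andbT; case/setDP: eST.
case/setDP: (eDT) => eD eT; case/setDP: eST => eS _.
have cDe : #|D :\ e| <= n by move: cardD; rewrite (cardsD1 e D) eD.
have SZ : S \in slice F e true by rewrite in_slice SF eS.
have [X SX] := IHP _ _ _ cDe (shifted_slice e true shF) SZ.
have XZ := hpath_end SX; have := XZ; rewrite in_slice eqb_id => /andP[XF eX].
have nTX : T != X by apply: contraTneq eX => <-.
have [u uTX] := setD_witness (cF _ _ TF XF) nTX.
have [YZ XY] := exitT shF topT TF eDT XZ uTX.
have [Z YZ'] := IHP _ _ _ cDe (shifted_slice e false shF) YZ.
exists Z; rewrite (slice_split F e true); apply: hpath_cat SX XY YZ' _.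
exact: slice_disjoint.
Qed.

Lemma shifted_hpath D F S : shifted D F -> S \in F -> exists S', hp F S S'.
Proof. by have [H _] := shifted_hpaths #|D|; apply: H. Qed.

(** If a path to T or to S1 is not available, then S1 is T - a' + b' for a pair
(a', b') at which F is pinched; since S1 contains b but not a, this pair is
(a, b). *)
Lemma end_choice D F T S0 S1 a b : shifted D F -> top D T -> T \in F ->
    S0 \in F -> S1 \in F -> a \in D -> b \in D -> r a < r b ->
    b \in S1 -> a \notin S1 ->
  pinched F D T a b \/ exists2 S, S = T \/ S = S1 & hp F S0 S.
Proof.
move=> shF topT TF S0F S1F aD bD ltab bS1 aS1.
have [_ IHT] := shifted_hpaths #|D|.
have toT X : X \in F -> X != T -> ~~ exceptional F D T X -> hp F X T by exact: (IHT D).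
have nS1T : S1 != T.
  apply: contraNneq aS1 => ES; apply: contraLR ltab => aT; rewrite -leqNgt ltnW //.
  by apply: topT; rewrite -ES inE ?bS1 ?aT.
have only a' b' : pinched F D T a' b' -> S1 = swap T a' b' -> pinched F D T a b.
  move=> rc ES; have /pinchedP[[a'TD b'DT] [am bm] _ _ _] := rc.
  case/setIP: (a'TD) => a'T a'D; case/setDP: (b'DT) => b'D b'T.
  move: bS1 aS1; rewrite ES !in_swap negb_or negb_and negbK => Hb /andP[nab' Ha].
  have bound t : b \in T -> False.
    move=> bT; case/orP: Ha => [/eqP Ea|aT].
      by have := am b; rewrite inE bT bD -Ea leqNgt ltab => /(_ isT).
    have := topT b a; rewrite !inE bT bD aT aD => /(_ isT isT).
    by rewrite ltnNge (ltnW ltab).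
  case/orP: Hb => [/eqP Eb|/andP[_ /bound]]; last by case.
  case/orP: Ha => [/eqP-> |aT]; first by rewrite Eb.
  have := bm a; rewrite inE aT aD => /(_ isT).
  by rewrite -Eb leqNgt ltab.
have [ES0|nS0T] := eqVneq S0 T.
  have [/exceptionalP[a' [b' [rc ES]]]|nex] := boolP (exceptional F D T S1).
    by left; apply: only rc ES.
  right; exists S1; first by right.
  by rewrite ES0; apply: hpath_rev (@exchange_sym V) _; apply: toT.
have [/exceptionalP[a' [b' [rc ES]]]|nex] := boolP (exceptional F D T S0); last first.
  by right; exists T; [left|apply: toT].
have [E|nS] := eqVneq S1 S0; first by left; apply: only rc _; rewrite E.
right; exists S1; first by right.
by rewrite ES; apply: (pinched_hpath shF topT TF rc) => //; rewrite -ES.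
Qed.

End Shifted.

(** * Edge moves and switches *)

Section Graphs.
Variable V : finType.
Implicit Types (G H K : {set {set V}}) (A : {set V}) (a b c p q t u v w : V).

Lemma set2_eq p q u w :
  ([set p; q] == [set u; w]) = (p == u) && (q == w) || (p == w) && (q == u).
Proof.
apply/eqP/idP=> [E|/orP[]/andP[/eqP-> /eqP->] //]; last by rewrite setUC.
have : p \in [set u; w] by rewrite -E set21.
have : q \in [set u; w] by rewrite -E set22.
have : u \in [set p; q] by rewrite E set21.
have : w \in [set p; q] by rewrite E set22.
rewrite !inE [u == p]eq_sym [u == q]eq_sym [w == p]eq_sym [w == q]eq_sym.
by do 4![case: eqP => _ //=].
Qed.

Definition nbhd G u := [set w | [set u; w] \in G].

Lemma in_nbhd G u w : (w \in nbhd G u) = ([set u; w] \in G).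
Proof. by rewrite inE. Qed.

Lemma nbhd_sym G u w : (w \in nbhd G u) = (u \in nbhd G w).
Proof. by rewrite !in_nbhd setUC. Qed.

Lemma nbhd_irr G u : simple_graph G -> u \notin nbhd G u.
Proof.
move/forall_inP=> sG; rewrite in_nbhd; apply/negP=> /sG.
by rewrite setUid cards1.
Qed.

Lemma nbhd_neq G u w : simple_graph G -> w \in nbhd G u -> w != u.
Proof. by move=> sG; apply: contraTneq => ->; apply: nbhd_irr. Qed.

Lemma graph_ext G H : simple_graph G -> simple_graph H -> nbhd G =1 nbhd H -> G = H.
Proof.
move=> /forall_inP sG /forall_inP sH E; apply/setP=> e.
have [/cards2P[u [w [_ ->]]]|ne] := boolP (#|e| == 2).
  by rewrite -!in_nbhd E.
by apply/idP/idP=> [/sG|/sH]; rewrite (negbTE ne).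
Qed.

Definition deg_in A G u := #|nbhd G u :&: A|.

(** All changes of graphs below, such as 2-switches and alternating hexagons,
are composed of these moves, each of which changes only two degrees. *)
Definition move_edge G c b a := [set c; a] |: (G :\ [set c; b]).

Definition movable G c b a := [&& b \in nbhd G c, a \notin nbhd G c & a != c].

Section Move.
Variables (G : {set {set V}}) (c b a : V).
Hypotheses (sG : simple_graph G) (mG : movable G c b a).

Let bc : b \in nbhd G c. Proof. by case/and3P: mG. Qed.
Let ac : a \notin nbhd G c. Proof. by case/and3P: mG. Qed.
Let nac : a != c. Proof. by case/and3P: mG. Qed.
Let nbc : b != c. Proof. exact: nbhd_neq bc. Qed.
Let nab : a != b. Proof. by apply: contraNneq ac => ->. Qed.

Lemma in_nbhd_move u w : (w \in nbhd (move_edge G c b a) u) =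
  ([set u; w] == [set c; a]) || ([set u; w] != [set c; b]) && (w \in nbhd G u).
Proof. by rewrite !in_nbhd /move_edge !inE. Qed.

Lemma move_simple : simple_graph (move_edge G c b a).
Proof.
apply/forall_inP=> e; rewrite !inE => /orP[/eqP->|/andP[_]].
  by rewrite cards2 [c == a]eq_sym nac.
by move/forall_inP: sG; apply.
Qed.

Lemma move_nbhd_c : nbhd (move_edge G c b a) c = swap (nbhd G c) b a.
Proof.
apply/setP=> w; rewrite in_nbhd_move in_swap !set2_eq eqxx /=.
rewrite [c == a]eq_sym (negbTE nac) [c == b]eq_sym (negbTE nbc) !orbF.
by [].
Qed.

Lemma move_nbhd_b : nbhd (move_edge G c b a) b = nbhd G b :\ c.
Proof.
apply/setP=> w; rewrite in_nbhd_move !inE !set2_eq eqxx /=.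
by rewrite (negbTE nbc) [b == a]eq_sym (negbTE nab).
Qed.

Lemma move_nbhd_a : nbhd (move_edge G c b a) a = c |: nbhd G a.
Proof.
apply/setP=> w; rewrite in_nbhd_move !inE !set2_eq eqxx /=.
by rewrite (negbTE nac) (negbTE nab).
Qed.

Lemma move_nbhd_other t : t != a -> t != b -> t != c ->
  nbhd (move_edge G c b a) t = nbhd G t.
Proof.
move=> nta ntb ntc; apply/setP=> w; rewrite in_nbhd_move !inE !set2_eq.
by rewrite (negbTE nta) (negbTE ntb) (negbTE ntc).
Qed.

Lemma move_deg A t : a \in A -> b \in A -> c \in A ->
  deg_in A (move_edge G c b a) t + (t == b) = deg_in A G t + (t == a).
Proof.
move=> aA bA cA; have [->|nta] := eqVneq t a.
  rewrite /deg_in move_nbhd_a (negbTE nab) addn0.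
  have -> : (c |: nbhd G a) :&: A = c |: (nbhd G a :&: A).
    by apply/setP=> w; rewrite !inE; case: eqP => //= ->; rewrite cA.
  by rewrite cardsU1 inE nbhd_sym (negbTE ac) addnC.
have [->|ntb] := eqVneq t b.
  rewrite /deg_in move_nbhd_b addn0.
  have -> : (nbhd G b :\ c) :&: A = (nbhd G b :&: A) :\ c.
    by apply/setP=> w; rewrite !inE andbA.
  by rewrite [in RHS](cardsD1 c) inE nbhd_sym bc cA addnC.
rewrite !addn0 /deg_in; have [->|ntc] := eqVneq t c; last by rewrite move_nbhd_other.
rewrite move_nbhd_c.
have -> : swap (nbhd G c) b a :&: A = swap (nbhd G c :&: A) b a.
  apply/setP=> w; rewrite !inE.
  by case: (w =P a) => [->|_] /=; rewrite ?aA // andbA.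
by rewrite card_swap // inE ?bc ?bA // (negbTE ac).
Qed.

Lemma move_out A t : a \in A -> b \in A -> c \in A -> t \notin A ->
  nbhd (move_edge G c b a) t = nbhd G t.
Proof.
by move=> aA bA cA tA; apply: move_nbhd_other; apply: contraNneq tA => ->.
Qed.

End Move.

Definition completions A G := [set H | [&& simple_graph H,
  [forall u, deg_in A H u == deg_in A G u] & [forall u in ~: A, nbhd H u == nbhd G u]]].

Lemma completionsP A G H : reflect
  [/\ simple_graph H, deg_in A H =1 deg_in A G & forall u, u \notin A -> nbhd H u = nbhd G u]
  (H \in completions A G).
Proof.
rewrite inE; apply: (iffP and3P) => [[-> /forallP d /forall_inP o]|[-> d o]].
  split=> // u; first exact/eqP.
  by move=> uA; apply/eqP; apply: o; rewrite inE.
split=> //; first by apply/forallP=> u; rewrite d.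
by apply/forall_inP=> u; rewrite inE => /o->.
Qed.

Lemma completions_refl A G : simple_graph G -> G \in completions A G.
Proof. by move=> sG; apply/completionsP. Qed.

Lemma completions_eq A G H : H \in completions A G -> completions A H = completions A G.
Proof.
case/completionsP=> sH dH oH; apply/setP=> K; apply/completionsP/completionsP=> -[sK dK oK].
  by split=> // u; [rewrite dK dH|move=> uA; rewrite oK // oH].
by split=> // u; [rewrite dK dH|move=> uA; rewrite oK // oH].
Qed.

Lemma completions_simple A G H : H \in completions A G -> simple_graph H.
Proof. by case/completionsP. Qed.

Lemma completions_deg A G H : H \in completions A G -> deg_in A H =1 deg_in A G.
Proof. by case/completionsP. Qed.

(** This is the 2-switch along the alternating 4-cycle v, u, w, u'. *)
Definition switch G v u u' w := move_edge (move_edge G v u u') w u' u.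

Section Switch.
Variables (G : {set {set V}}) (v u u' w : V).
Hypotheses (sG : simple_graph G).
Hypotheses (uv : u \in nbhd G v) (u'v : u' \notin nbhd G v) (nu'v : u' != v).
Hypotheses (wu' : w \in nbhd G u') (wu : w \notin nbhd G u) (nwu : w != u).

Let nvw : v != w. Proof. by apply: contraTneq uv => ->; rewrite nbhd_sym. Qed.
Let nuu' : u != u'. Proof. by apply: contraTneq uv => ->. Qed.
Let nvu : v != u. Proof. by rewrite eq_sym; apply: nbhd_neq uv. Qed.
Let nwu' : w != u'. Proof. exact: nbhd_neq wu'. Qed.
Let m1 : movable G v u u'. Proof. by rewrite /movable uv u'v. Qed.
Let s1 := move_simple sG m1.

Let nb1w : nbhd (move_edge G v u u') w = nbhd G w.
Proof. by apply: move_nbhd_other => //; rewrite eq_sym. Qed.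

Let m2 : movable (move_edge G v u u') w u' u.
Proof. by rewrite /movable nb1w nbhd_sym wu' nbhd_sym wu eq_sym. Qed.

Lemma switch_nbhd_v : nbhd (switch G v u u' w) v = swap (nbhd G v) u u'.
Proof. by rewrite /switch move_nbhd_other ?move_nbhd_c // eq_sym. Qed.

Lemma switch_nbhd_w : nbhd (switch G v u u' w) w = swap (nbhd G w) u' u.
Proof. by rewrite /switch move_nbhd_c // nb1w. Qed.

Lemma switch_completions A : v \in A -> u \in A -> u' \in A -> w \in A ->
  switch G v u u' w \in completions A G.
Proof.
move=> vA uA u'A wA; apply/completionsP; split; first exact: move_simple.
  move=> t; apply: (@addIn (t == u')).
  by rewrite /switch (move_deg s1 m2) // (move_deg sG m1).
by move=> t tA; rewrite /switch (move_out _ uA u'A wA) ?(move_out _ u'A uA vA).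
Qed.

Lemma switch_symdiff : #|symdiff G (switch G v u u' w)| = 4.
Proof.
have e1 : [set v; u] \in G by rewrite -in_nbhd.
have e2 : [set w; u'] \in G by rewrite -in_nbhd nbhd_sym.
have e3 : [set v; u'] \notin G by rewrite -in_nbhd.
have e4 : [set w; u] \notin G by rewrite -in_nbhd nbhd_sym.
have D1 : G :\: switch G v u u' w = [set [set v; u]; [set w; u']].
  apply/setP=> e; rewrite !inE !negb_or !negb_and !negbK.
  have [->|n1] := eqVneq e [set v; u].
    rewrite e1 !andbT /= !set2_eq !eqxx (negbTE nvw) (negbTE nuu').
    by rewrite [u == v]eq_sym (negbTE nvu) !andbF !orbF !orbT.
  have [->|n2] := eqVneq e [set w; u'].
    by rewrite e2 /= !set2_eq !eqxx [u' == u]eq_sym (negbTE nuu') (negbTE nwu).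
  by case: (e \in G); rewrite /= ?orbT ?andbF.
have D2 : switch G v u u' w :\: G = [set [set v; u']; [set w; u]].
  apply/setP=> e; rewrite !inE.
  have [->|n1] := eqVneq e [set v; u'].
    rewrite e3 /= !set2_eq !eqxx (negbTE nvw) [v == u']eq_sym (negbTE nu'v).
    by rewrite /= !orbT.
  have [->|n2] := eqVneq e [set w; u]; first by rewrite e4 orbT.
  by case eG: (e \in G); rewrite ?andbF.
rewrite /symdiff cardsU D1 D2.
have -> : [set [set v; u]; [set w; u']] :&: [set [set v; u']; [set w; u]] = set0.
  apply/setP=> e; rewrite !inE; apply/negP=> /andP[/orP[]/eqP-> /orP[]/eqP E];
  by move: e1 e2; rewrite ?E ?(negbTE e3) ?(negbTE e4).
rewrite cards0 !cards2 !set2_eq (negbTE nvw) [v == u']eq_sym (negbTE nu'v).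
by rewrite (negbTE nvu).
Qed.

End Switch.

(** Otherwise every neighbour of u' except u would be a neighbour of u, and v
would make this inclusion strict, against the degrees. *)
Lemma excess_neighbour A G u u' v : simple_graph G -> u \in A -> u' \in A -> v \in A ->
    v \in nbhd G u -> v \notin nbhd G u' -> v != u' -> deg_in A G u <= deg_in A G u' ->
  exists w, [/\ w \in A, w \in nbhd G u', w \notin nbhd G u & w != u].
Proof.
move=> sG uA u'A vA vu vu' nvu' le.
have [/exists_inP[w wA /and3P[? ? ?]]|none] :=
  boolP [exists w in A, [&& w \in nbhd G u', w \notin nbhd G u & w != u]]; first by exists w.
have sub : (nbhd G u' :&: A) :\ u \subset (nbhd G u :&: A) :\ u'.
  apply/subsetP=> w; rewrite !inE -!in_nbhd => /and3P[nwu wu' wA].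
  rewrite (nbhd_neq sG wu') wA andbT /=; apply: contraNT none => wu.
  by apply/exists_inP; exists w; rewrite // wu' wu nwu.
have eqc : #|(nbhd G u :&: A) :\ u'| <= #|(nbhd G u' :&: A) :\ u|.
  have := cardsD1 u (nbhd G u' :&: A); have := cardsD1 u' (nbhd G u :&: A).
  rewrite !in_setI uA u'A [u \in nbhd G u']nbhd_sym; rewrite /deg_in in le; lia.
have /eqP E : (nbhd G u' :&: A) :\ u == (nbhd G u :&: A) :\ u' by rewrite eqEcard sub.
have : v \in (nbhd G u :&: A) :\ u' by rewrite !inE nvu' -in_nbhd vu.
by rewrite -E !inE -in_nbhd (negbTE vu') andbF.
Qed.

End Graphs.

(** * Degrees around a pinched vertex *)

Section Pinched.
Variable V : finType.
Implicit Types (G H K : {set {set V}}) (A C : {set V}) (a b c p q t u v w z : V).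

Lemma label_swap A G K v u a : u \in A -> a \in A ->
  nbhd K v = swap (nbhd G v) u a -> nbhd K v :&: A = swap (nbhd G v :&: A) u a.
Proof.
move=> uA aA ->; apply/setP=> x; rewrite !inE.
by case: (x =P a) => [->|_] /=; rewrite ?aA // andbA.
Qed.

(** Along the alternating closed walk v, u, p, q, t, a the three moves at v, p
and t cancel in all degrees. The case t = u, in which the walk consists of two
triangles, is included. *)
Lemma hexagon A G v u a p q t : simple_graph G ->
    [/\ v \in A, u \in A & a \in A] -> [/\ p \in A, q \in A & t \in A] ->
    u \in nbhd G v -> a \notin nbhd G v -> a != v ->
    u \notin nbhd G p -> u != p -> q \in nbhd G p -> t \notin nbhd G q -> t != q ->
    t \in nbhd G a -> p != v -> p != a -> q != v -> q != a -> t != p ->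
  exists2 K, K \in completions A G & nbhd K v = swap (nbhd G v) u a.
Proof.
move=> sG [vA uA aA] [pA qA tA] uv av nav up nup qp tq ntq ta npv npa nqv nqa ntp.
have nuv := nbhd_neq sG uv.
have ntv : t != v by apply: contraNneq av => <-; rewrite nbhd_sym.
have nta := nbhd_neq sG ta.
have nua : u != a by apply: contraNneq av => <-.
have nqu : q != u by apply: contraNneq up => <-.
have nqp := nbhd_neq sG qp.
have [nau naq nap] : [/\ a != u, a != q & a != p] by rewrite ![a == _]eq_sym.
have [nva nvt nvu] : [/\ v != a, v != t & v != u] by rewrite ![v == _]eq_sym.
have [nvp nvq] : v != p /\ v != q by rewrite ![v == _]eq_sym.
have npu : p != u by rewrite eq_sym.
have nqt : q != t by rewrite eq_sym.
have m1 : movable G v u a by rewrite /movable uv av.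
have s1 := move_simple sG m1; set G1 := move_edge G v u a in s1.
have p1 : nbhd G1 p = nbhd G p by apply: move_nbhd_other.
have m2 : movable G1 p q u by rewrite /movable p1 qp up.
have s2 := move_simple s1 m2; set G2 := move_edge G1 p q u in s2.
have a2 : nbhd G2 a = v |: nbhd G a.
  by rewrite move_nbhd_other // (move_nbhd_a m1).
have q2 : nbhd G2 q = nbhd G q :\ p by rewrite (move_nbhd_b s1 m2) move_nbhd_other.
have m3 : movable G2 t a q.
  by rewrite /movable nbhd_sym a2 in_setU1 ta orbT nbhd_sym q2 in_setD1 (negbTE tq) andbF.
exists (move_edge G2 t a q); last first.
  have v1 : nbhd G1 v = swap (nbhd G v) u a := move_nbhd_c sG m1.
  by rewrite move_nbhd_other // move_nbhd_other.
apply/completionsP; split; first exact: move_simple.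
  move=> x; have := move_deg sG m1 x aA uA vA; have := move_deg s1 m2 x uA qA pA.
  have := move_deg s2 m3 x qA aA tA; rewrite -/G1 -/G2.
  move: (deg_in A _ x) (deg_in A G2 x) (deg_in A G1 x) (deg_in A G x)
    (x == a : nat) (x == u : nat) (x == q : nat).
  clear; lia.
move=> x xA; rewrite (move_out _ qA aA tA) // (move_out _ uA qA pA) //.
by rewrite (move_out _ aA uA vA).
Qed.

(** Suppose that the labels f + C and a + b + C - u of v occur, but no label
g + a + C - w with w in C; this is what a pinched family looks like with
C = T - a. If d(a) < d(v) = |C| + 1, a contradiction arises as follows. Let Y
have label f + C. A switch or hexagon in Y that trades a neighbour w in C of v
for a is impossible. This makes the vertices outside C + v independent
([outside_independent]), and makes the set [core] of the vertices of C with a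
neighbour outside C + v complete to C ([core_complete]). So the degree sum
over [core] is as large as the degrees of the vertices outside C + v permit,
up to the single edge vf. In a graph with label a + b + C - u two edges, va and
vb, are lost instead, so its degree sum over [core] is smaller. *)
Section DegreeBound.
Variables (A : {set V}) (G : {set {set V}}) (v a b : V) (C : {set V}).
Hypotheses (vA : v \in A) (aA : a \in A) (bA : b \in A) (nab : a != b).
Hypotheses (CA : C \subset A) (vC : v \notin C).
Hypotheses (av : a != v) (aC : a \notin C) (bv : b != v) (bC : b \notin C).
Hypothesis forbidden : forall K w g, K \in completions A G -> w \in C ->
  g \in A -> g \notin [set v; a; b] -> g \notin C ->
  nbhd K v :&: A != g |: (a |: (C :\ w)).
Hypothesis dmax : forall z, z \in A -> z \notin C -> z != v -> deg_in A G z <= deg_in A G a.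

Section Contradiction.
Variables (f u : V) (Y Y2 : {set {set V}}).
Hypotheses (fA : f \in A) (fvab : f \notin [set v; a; b]) (fC : f \notin C).
Hypotheses (YG : Y \in completions A G) (YE : nbhd Y v :&: A = f |: C).
Hypotheses (uC : u \in C) (Y2G : Y2 \in completions A G).
Hypothesis Y2E : nbhd Y2 v :&: A = a |: (b |: (C :\ u)).
Hypothesis lt_av : deg_in A G a < deg_in A G v.

Let inA w : w \in C -> w \in A. Proof. exact: (subsetP CA). Qed.
Let sY : simple_graph Y. Proof. exact: completions_simple YG. Qed.
Let dY : deg_in A Y =1 deg_in A G. Proof. exact: completions_deg. Qed.
Let nfv : f != v. Proof. by apply: contraNneq fvab => ->; rewrite !inE eqxx. Qed.
Let nfa : f != a. Proof. by apply: contraNneq fvab => ->; rewrite !inE eqxx orbT. Qed.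

Let vnb w : w \in A -> (w \in nbhd Y v) = (w == f) || (w \in C).
Proof. by move=> wA; have /setP/(_ w) := YE; rewrite in_setI wA andbT in_setU1. Qed.

Let dgv : deg_in A G v = #|C|.+1.
Proof. by rewrite -dY /deg_in YE cardsU1 fC. Qed.

Let dga : deg_in A G a <= #|C|.
Proof. by move: lt_av; rewrite dgv ltnS. Qed.

Let av_nbhd : a \notin nbhd Y v.
Proof. by rewrite vnb // negb_or aC eq_sym nfa. Qed.

Let no_exchange K w : K \in completions A Y -> w \in C -> nbhd K v != swap (nbhd Y v) w a.
Proof.
move=> KY wC; apply/eqP=> E; rewrite (completions_eq YG) in KY.
have := forbidden KY wC fA fvab fC; rewrite (label_swap (inA wC) aA E) YE.
case/eqP; apply/setP=> x; rewrite !inE.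
case: (x =P f) => [->|_] /=; last by [].
by rewrite andbT; apply/orP; right; apply: contraNneq fC => ->.
Qed.

Let no_switch w p : w \in C -> p \in A -> p \in nbhd Y a -> p != w -> p \in nbhd Y w.
Proof.
move=> wC pA pa npw; apply: contraT => pw.
have wv : w \in nbhd Y v by rewrite vnb ?inA // wC orbT.
have := no_exchange (switch_completions sY wv av_nbhd av pa pw npw vA (inA wC) aA pA) wC.
by rewrite switch_nbhd_v // eqxx.
Qed.

Let no_hexagon w p q t : w \in C -> p \in A -> q \in A -> t \in A ->
  w \notin nbhd Y p -> w != p -> q \in nbhd Y p -> t \notin nbhd Y q -> t != q ->
  t \in nbhd Y a -> p != v -> p != a -> q != v -> q != a -> t != p -> False.
Proof.
move=> wC pA qA tA wp nwp qp tq ntq ta npv npa nqv nqa ntp.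
have wv : w \in nbhd Y v by rewrite vnb ?inA // wC orbT.
have [K KY] := hexagon sY (And3 vA (inA wC) aA) (And3 pA qA tA) wv av_nbhd av wp nwp
  qp tq ntq ta npv npa nqv nqa ntp.
by apply/eqP; apply: no_exchange.
Qed.

(* C is too large to consist of neighbours of z, as d(z) <= d(a) <= |C|. *)
Let far z z' : z \in A -> z \notin C -> z != v -> z' \in A -> z' \notin C ->
  z' \in nbhd Y z -> exists2 w, w \in C & w \notin nbhd Y z.
Proof.
move=> zA zC nzv z'A z'C z'z.
have [sub|/subsetPn[w wC wz]] := boolP (C \subset nbhd Y z); last by exists w.
have : #|z' |: C| <= deg_in A Y z.
  apply: subset_leq_card; apply/subsetP=> x; rewrite in_setU1 in_setI.
  by case/orP=> [/eqP->|xC]; [rewrite z'z|rewrite (subsetP sub) ?inA].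
rewrite cardsU1 z'C dY => le.
by have := leq_trans (leq_trans le (dmax zA zC nzv)) dga; rewrite ltnn.
Qed.

Let nbhd_a_C p : p \in A -> p \in nbhd Y a -> p \in C.
Proof.
move=> pA pa; apply: contraT => pC.
have npv : p != v by apply: contraNneq av_nbhd => <-; rewrite nbhd_sym.
have [|w wC wp] := far pA pC npv aA aC; first by rewrite nbhd_sym.
have npw : p != w by apply: contraNneq pC => ->.
by have := no_switch wC pA pa npw; rewrite nbhd_sym (negbTE wp).
Qed.

Let missing z p : z \in A -> z \notin C -> z != v -> p \in A -> p \in nbhd Y z ->
  p \notin nbhd Y a -> exists t, [/\ t \in A, t \in nbhd Y a & t \notin nbhd Y z].
Proof.
move=> zA zC nzv pA pz pa.
have [sub|/subsetPn[t]] := boolP (nbhd Y a :&: A \subset nbhd Y z); last first.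
  by case/setIP=> ta tA tz; exists t.
have : #|p |: (nbhd Y a :&: A)| <= deg_in A Y z.
  apply: subset_leq_card; apply/subsetP=> x; rewrite in_setU1 [x \in _ :&: _ in X in _ -> X]in_setI.
  case/orP=> [/eqP->|xa]; first by rewrite pz.
  by rewrite (subsetP sub) //; case/setIP: xa.
rewrite cardsU1 in_setI (negbTE pa) -/(deg_in A Y a) !dY => le.
by have := leq_trans le (dmax zA zC nzv); rewrite ltnn.
Qed.

Let outside_independent z z' : z \in A -> z \notin C -> z != v ->
  z' \in A -> z' \notin C -> z' != v -> z' \notin nbhd Y z.
Proof.
move=> zA zC nzv z'A z'C nz'v; apply/negP=> z'z.
have zz' : z \in nbhd Y z' by rewrite nbhd_sym.
have [w wC wz] := far zA zC nzv z'A z'C z'z.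
have nza : z != a by apply: contraNneq z'C => E; apply: nbhd_a_C; rewrite // -E.
have nz'a : z' != a by apply: contraNneq zC => E; apply: nbhd_a_C; rewrite // -E.
have za : z \notin nbhd Y a by apply: contraNN zC => za; apply: nbhd_a_C.
have [t [tA ta tz']] := missing z'A z'C nz'v zA zz' za.
have tC := nbhd_a_C tA ta.
apply: (no_hexagon wC zA z'A tA wz _ z'z tz' _ ta) => //.
- by apply: contraNneq zC => <-.
- by apply: contraNneq z'C => <-.
- by apply: contraNneq zC => <-.
Qed.

Let core := [set r in C | [exists q in A, [&& q \notin C, q != v & q \in nbhd Y r]]].

Let core_complete r w : r \in core -> w \in C -> w != r -> w \in nbhd Y r.
Proof.
rewrite inE => /andP[rC /exists_inP[q qA /and3P[qC nqv qr]]] wC nwr.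
have rA := inA rC; apply: contraT => wr.
have nrw : r != w by rewrite eq_sym.
have ra : r \notin nbhd Y a.
  by apply: contraNN wr => ra; rewrite nbhd_sym; apply: no_switch.
have nqa : q != a by apply: contraNneq ra => <-; rewrite nbhd_sym.
have rq : r \in nbhd Y q by rewrite nbhd_sym.
have [t [tA ta tq]] := missing qA qC nqv rA rq ra.
have tC := nbhd_a_C tA ta.
exfalso; apply: (no_hexagon wC rA qA tA wr nwr qr tq _ ta) => //.
- by apply: contraNneq qC => <-.
- by apply: contraNneq vC => <-.
- by apply: contraNneq aC => <-.
- by apply: contraNneq ra => <-.
Qed.

Let Z := A :\: (v |: C).

Let inZ z : (z \in Z) = [&& z \in A, z \notin C & z != v].
Proof. by rewrite !inE negb_or andbC [(z != v) && _]andbC. Qed.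

Let card_count (S X : {set V}) : #|S :&: X| = \sum_(z in X) (z \in S : nat).
Proof.
rewrite -sum1_card big_mkcond [RHS]big_mkcond; apply: eq_bigr => z _.
by rewrite in_setI; case: (z \in S); case: (z \in X).
Qed.

Let double_count H :
  \sum_(r in core) #|nbhd H r :&: Z| = \sum_(z in Z) #|nbhd H z :&: core|.
Proof.
under eq_bigr => r _ do rewrite card_count.
under [RHS]eq_bigr => z _ do rewrite card_count.
rewrite exchange_big /=; apply: eq_bigr => z _; apply: eq_bigr => r _.
by rewrite nbhd_sym.
Qed.

Let core_C r : r \in core -> r \in C.
Proof. by rewrite inE => /andP[]. Qed.

Let core_v : v \notin core.
Proof. by apply: contraNN vC => /core_C. Qed.

Let core_bound H r : H \in completions A G -> r \in core ->
  deg_in A G r <= #|C| + #|nbhd H r :&: Z|.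
Proof.
move=> HG rc; have rC := core_C rc; rewrite -(completions_deg HG) /deg_in.
apply: leq_trans (_ : #|(v |: (C :\ r)) :|: (nbhd H r :&: Z)| <= _).
  apply/subset_leq_card/subsetP=> x; rewrite !in_setU !in_setI in_set1 inZ in_setD1.
  case/andP=> xr ->; rewrite xr (nbhd_neq (completions_simple HG) xr) /=.
  by case: (x == v); case: (x \in C).
apply: leq_trans (leq_card_setU _ _) _; rewrite leq_add2r.
rewrite cardsU1 in_setD1 (negbTE vC) andbF /=.
by rewrite (cardsD1 r C) rC.
Qed.

Let core_exact r : r \in core -> #|C| + #|nbhd Y r :&: Z| <= deg_in A G r.
Proof.
move=> rc; have rC := core_C rc; rewrite -dY /deg_in.
have -> : #|C| = #|v |: (C :\ r)|.
  by rewrite cardsU1 in_setD1 (negbTE vC) andbF /= (cardsD1 r C) rC.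
rewrite -cardsUI; have -> : (v |: C :\ r) :&: (nbhd Y r :&: Z) = set0.
  apply/setP=> x; rewrite !in_setI in_setU1 in_setD1 inZ in_set0.
  by case: (x == v); case: (x \in C); rewrite ?andbF.
rewrite cards0 addn0; apply/subset_leq_card/subsetP=> x.
rewrite in_setU in_setU1 in_setD1 !in_setI inZ.
case/orP=> [/orP[/eqP->|/andP[nxr xC]]|/and3P[-> -> _] //].
  by rewrite vA nbhd_sym vnb ?inA // rC orbT.
by rewrite inA // core_complete.
Qed.

Let outside_exact z : z \in Z -> deg_in A G z <= #|nbhd Y z :&: core| + (z == f).
Proof.
rewrite inZ => /and3P[zA zC nzv]; rewrite -dY /deg_in.
have sub : nbhd Y z :&: A \subset (nbhd Y z :&: core) :|: [set x in [set v] | z == f].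
  apply/subsetP=> x; rewrite in_setI in_setU in_setI !inE -in_nbhd => /andP[xz xA].
  have [Ex|nxv] := eqVneq x v.
    by move: xz; rewrite Ex nbhd_sym vnb // (negbTE zC) orbF => ->; rewrite orbT.
  rewrite xz orbF /=; have xC : x \in C.
    apply: contraT => xC; have := outside_independent zA zC nzv xA xC nxv.
    by rewrite xz.
  by rewrite xC; apply/exists_inP; exists z; rewrite // zC nzv nbhd_sym.
apply: leq_trans (subset_leq_card sub) _; apply: leq_trans (leq_card_setU _ _) _.
rewrite leq_add2l; case: (z == f).
  rewrite -[nat_of_bool true](cards1 v) subset_leq_card //.
  by apply/subsetP=> x; rewrite inE andbT.
by rewrite leqn0 cards_eq0; apply/eqP/setP=> x; rewrite !inE andbF.
Qed.

Let outside_bound z : z \in Z ->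
  #|nbhd Y2 z :&: core| + ((z == a) + (z == b)) <= deg_in A G z.
Proof.
rewrite inZ => /and3P[zA zC nzv]; rewrite -(completions_deg Y2G) /deg_in.
have sub : nbhd Y2 z :&: core \subset (nbhd Y2 z :&: A) :\ v.
  apply/subsetP=> x; rewrite in_setD1 !in_setI => /andP[-> xc].
  by rewrite /= (inA (core_C xc)) andbT; apply: contraNneq core_v => <-.
have := subset_leq_card sub; have := cardsD1 v (nbhd Y2 z :&: A).
rewrite in_setI vA nbhd_sym andbT.
have /setP/(_ z) := Y2E; rewrite in_setI zA andbT => ->.
rewrite !in_setU1 in_setD1 (negbTE zC) andbF orbF => -> le.
rewrite addnC; apply: leq_add le.
have [->|_] := eqVneq z a; first by rewrite (negbTE nab).
by rewrite add0n.
Qed.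

Let sum_one x : x \in Z -> \sum_(z in Z) (z == x : nat) = 1.
Proof.
move=> xZ; rewrite (big_setD1 x xZ) /= eqxx big1 // => z.
by rewrite in_setD1 => /andP[/negbTE->].
Qed.

Lemma pinched_contradiction : False.
Proof.
have fZ : f \in Z by rewrite inZ fA fC.
have aZ : a \in Z by rewrite inZ aA aC.
have bZ : b \in Z by rewrite inZ bA bC.
have lower : \sum_(r in core) #|C| + \sum_(z in Z) #|nbhd Y z :&: core| <=
    \sum_(r in core) deg_in A G r.
  by rewrite -double_count -big_split; apply: leq_sum => r; apply: core_exact.
have upper : \sum_(r in core) deg_in A G r <=
    \sum_(r in core) #|C| + \sum_(z in Z) #|nbhd Y2 z :&: core|.
  by rewrite -double_count -big_split; apply: leq_sum => r; apply: core_bound.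
have : \sum_(z in Z) deg_in A G z <= \sum_(z in Z) #|nbhd Y z :&: core| + 1.
  by rewrite -(sum_one fZ) -big_split; apply: leq_sum => z; apply: outside_exact.
have : \sum_(z in Z) #|nbhd Y2 z :&: core| + 2 <= \sum_(z in Z) deg_in A G z.
  rewrite -[2]/(1 + 1) -{1}(sum_one aZ) -(sum_one bZ) -big_split -big_split.
  by apply: leq_sum => z; apply: outside_bound.
move: lower upper.
move: (\sum_(r in core) #|C|) (\sum_(z in Z) #|nbhd Y z :&: core|)
 (\sum_(r in core) deg_in A G r) (\sum_(z in Z) #|nbhd Y2 z :&: core|)
 (\sum_(z in Z) deg_in A G z).
by clear; lia.
Qed.

End Contradiction.

Lemma pinched_deg_le f u Y Y2 : f \in A -> f \notin [set v; a; b] -> f \notin C ->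
    Y \in completions A G -> nbhd Y v :&: A = f |: C -> u \in C -> Y2 \in completions A G ->
    nbhd Y2 v :&: A = a |: (b |: (C :\ u)) ->
  deg_in A G v <= deg_in A G a.
Proof.
move=> fA fvab fC YG YE uC Y2G Y2E; rewrite leqNgt; apply/negP=> lt_av.
exact: (pinched_contradiction fA fvab fC YG YE Y2G Y2E lt_av).
Qed.

End DegreeBound.

End Pinched.

Section Complement.
Variable V : finType.
Implicit Types (G H K : {set {set V}}) (A C : {set V}) (a b c p q t u v w z : V).

Definition compl G := [set e : {set V} | (#|e| == 2) && (e \notin G)].

Lemma in_nbhd_compl G u w : (w \in nbhd (compl G) u) = (w != u) && (w \notin nbhd G u).
Proof. by rewrite !in_nbhd inE cards2 eqSS eqb1 eq_sym. Qed.

Lemma compl_simple G : simple_graph (compl G).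
Proof. by apply/forall_inP=> e; rewrite inE => /andP[]. Qed.

Lemma complK G : simple_graph G -> compl (compl G) = G.
Proof.
move=> sG; apply: (graph_ext (compl_simple _) sG) => u; apply/setP=> w.
rewrite !in_nbhd_compl; case: eqP => [->|_] /=; last by rewrite negbK.
by rewrite (negbTE (nbhd_irr u sG)).
Qed.

Lemma compl_deg A G u : simple_graph G ->
  deg_in A (compl G) u + (deg_in A G u + (u \in A)) = #|A|.
Proof.
move=> sG; rewrite -(cardsID (u |: nbhd G u) A) addnC; congr (_ + _).
  have [uA|uA] := boolP (u \in A).
    have -> : A :&: (u |: nbhd G u) = u |: (nbhd G u :&: A).
      apply/setP=> w; rewrite !(in_setI, in_setU1) andbC.
      by case: eqP => //= ->; rewrite uA.
    by rewrite cardsU1 in_setI (negbTE (nbhd_irr u sG)) addnC.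
  rewrite addn0; apply: eq_card => w; rewrite !(in_setI, in_setU1) andbC.
  by case: eqP => //= ->; rewrite (negbTE uA).
by apply: eq_card => w; rewrite in_setI in_setD in_nbhd_compl in_setU1 negb_or.
Qed.

Lemma compl_completions A G H : simple_graph G -> H \in completions A G ->
  compl H \in completions A (compl G).
Proof.
move=> sG /completionsP[sH dH oH]; apply/completionsP; split; first exact: compl_simple.
  move=> u; apply/eqP; rewrite -(eqn_add2r (deg_in A G u + (u \in A))).
  by rewrite (compl_deg A u sG) -dH compl_deg.
by move=> u uA; apply/setP=> w; rewrite !in_nbhd_compl oH.
Qed.

Lemma compl_label A G v x : x \in A ->
  (x \in nbhd (compl G) v :&: A) = (x != v) && (x \notin nbhd G v :&: A).
Proof. by move=> xA; rewrite !in_setI in_nbhd_compl xA !andbT. Qed.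

(** Complementation turns this into [pinched_deg_le]: the roles of a and b are
exchanged, and C is replaced by the vertices other than v, a, b outside C. *)
Lemma pinched_deg_ge A G v a b C f u Y Y2 : simple_graph G ->
    v \in A -> a \in A -> b \in A -> a != b -> C \subset A -> v \notin C ->
    a != v -> a \notin C -> b != v -> b \notin C ->
    (forall K w g, K \in completions A G -> w \in C ->
      g \in A -> g \notin [set v; a; b] -> g \notin C ->
      nbhd K v :&: A != g |: (a |: (C :\ w))) ->
    {in C, forall z, deg_in A G b <= deg_in A G z} -> deg_in A G b <= deg_in A G a ->
    f \in A -> f \notin [set v; a; b] -> f \notin C ->
    Y \in completions A G -> nbhd Y v :&: A = f |: C -> u \in C -> Y2 \in completions A G ->
    nbhd Y2 v :&: A = a |: (b |: (C :\ u)) ->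
  deg_in A G b <= deg_in A G v.
Proof.
move=> sG vA aA bA nab CA vC av aC bv bC forb dC dab fA fvab fC YG YE uC Y2G Y2E.
have inA := subsetP CA.
pose L := A :\: (v |: (a |: (b |: C))).
have inL x : (x \in L) = [&& x \in A, x != v, x != a, x != b & x \notin C].
  by rewrite in_setD !in_setU1 !negb_or andbC.
have vab x : (x \notin [set v; a; b]) = [&& x != v, x != a & x != b].
  by rewrite !inE !negb_or -andbA.
have inC x : x \in C -> [&& x != v, x != a & x != b].
  by move=> xC; apply/and3P; split; apply: contraTneq xC => ->.
have nba : b != a by rewrite eq_sym.
have co_le z : z \in A -> deg_in A G b <= deg_in A G z ->
    deg_in A (compl G) z <= deg_in A (compl G) b.
  move=> zA; have := compl_deg A z sG; have := compl_deg A b sG; rewrite zA bA.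
  by move: (deg_in A _ b) (deg_in A _ b) (deg_in A _ z) (deg_in A _ z); clear; lia.
have vE : deg_in A (compl G) v <= deg_in A (compl G) b -> deg_in A G b <= deg_in A G v.
  have := compl_deg A v sG; have := compl_deg A b sG; rewrite vA bA.
  by move: (deg_in A _ b) (deg_in A _ b) (deg_in A _ v) (deg_in A _ v); clear; lia.
apply: vE; apply: (@pinched_deg_le V A (compl G) v b a L vA bA aA nba _ _ bv _ av _ _ _
  u f (compl Y2) (compl Y)).
- by apply/subsetP=> x; rewrite inL => /andP[].
- by rewrite inL eqxx andbF.
- by rewrite inL eqxx ?andbF.
- by rewrite inL eqxx ?andbF.
- move=> K w g KG; rewrite inL => /and5P[wA nwv nwa nwb wC] gA.
  move=> gvab gL; have gC : g \in C.
    apply: contraNT gL => gC; rewrite inL gA gC.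
    by move: gvab; rewrite !inE !negb_or => /andP[/andP[-> ->] ->].
  have coKG : compl K \in completions A G.
    by rewrite -(complK sG); apply: compl_completions KG; apply: compl_simple.
  have wvab : w \notin [set v; a; b] by rewrite vab nwv nwa.
  apply: contraNneq (forb _ _ _ coKG gC wA wvab wC) => E.
  apply/eqP/setP=> x; have [xA|xA] := boolP (x \in A); last first.
    rewrite in_setI (negbTE xA) andbF; apply/esym/negbTE; apply: contra xA.
    rewrite !in_setU1 in_setD1 => /or3P[/eqP->|/eqP->|/andP[_ /inA]] //.
  rewrite compl_label // E !(in_setU1, in_setD1) inL xA.
  have [->|nxg] := eqVneq x g.
    have /and3P[_ nga _] := inC g gC.
    by rewrite (negbTE nga) /= andbF orbF; apply/esym/negbTE; apply: contraNneq wC => <-.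
  have [->|nxw] := eqVneq x w; first by rewrite nwv (negbTE nwb).
  have [->|nxa] := eqVneq x a; first by rewrite av (negbTE nab) /= ?andbF.
  have [->|nxb] := eqVneq x b; first by rewrite (negbTE bC) /= ?andbF.
  have [->|nxv] := eqVneq x v; first by rewrite (negbTE vC).
  by rewrite /= negbK.
- move=> z zA zL nzv; apply: co_le => //.
  have [->|nza] := eqVneq z a; first exact: dab.
  have [->|nzb] := eqVneq z b; first exact: leqnn.
  by apply: dC; apply: contraNT zL => zC; rewrite inL zA nzv nza nzb.
- exact: inA.
- by rewrite !inE !negb_or; case/and3P: (inC u uC) => -> -> ->.
- by rewrite inL uC !andbF.
- exact: compl_completions.
- apply/setP=> x; have [xA|xA] := boolP (x \in A); last first.
    rewrite in_setI (negbTE xA) andbF; apply/esym/negbTE; apply: contra xA.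
    by rewrite in_setU1 inL => /orP[/eqP->|/andP[]//]; apply: inA.
  rewrite compl_label // Y2E !(in_setU1, in_setD1) inL xA.
  have [->|nxu] := eqVneq x u; first by case/and3P: (inC u uC) => -> /negbTE-> /negbTE->.
  have [->|nxa] := eqVneq x a; first by rewrite /= ?andbF.
  have [->|nxb] := eqVneq x b; first by rewrite /= ?andbF.
  by rewrite /=.
- by rewrite inL fA fC andbT; rewrite vab in fvab.
- exact: compl_completions.
- apply/setP=> x; have [xA|xA] := boolP (x \in A); last first.
    rewrite in_setI (negbTE xA) andbF; apply/esym/negbTE; apply: contra xA.
    rewrite !in_setU1 in_setD1 inL => /or3P[/eqP->|/eqP->|/and3P[]] //.
  rewrite compl_label // YE !(in_setU1, in_setD1) inL xA.
  move: fvab; rewrite vab => /and3P[nfv nfa nfb].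
  have [->|nxf] := eqVneq x f; first by rewrite (negbTE nfa) (negbTE nfb) /= ?andbF.
  have [->|nxa] := eqVneq x a; first by rewrite av aC (negbTE nab).
  have [->|nxb] := eqVneq x b; first by rewrite bv bC.
  by rewrite /=.
Qed.

End Complement.

(** * Neighbourhoods of a vertex as a shifted family *)

Section Labels.
Variable V : finType.
Implicit Types (G H K Y : {set {set V}}) (A C S T : {set V}) (a b c p q t u v w z : V).
Local Notation hp := (hpath (@exchange V)).

Definition label A v G := nbhd G v :&: A.
Definition labels A v G := label A v @: completions A G.

Lemma deg_inD1 A G v u : v \in A -> deg_in A G u = deg_in (A :\ v) G u + (u \in nbhd G v).
Proof.
move=> vA; rewrite /deg_in (cardsD1 v) in_setI vA andbT nbhd_sym addnC; congr (_ + _).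
by apply: eq_card => w; rewrite !(in_setI, in_setD1) andbCA.
Qed.

Lemma label_sub A v G w : simple_graph G -> w \in label A v G -> w \in A :\ v.
Proof.
by move=> sG; rewrite in_setI in_setD1 => /andP[wv ->]; rewrite (nbhd_neq sG wv).
Qed.

(** Fixing the label of v amounts to removing v from the free vertices. *)
Lemma fiberE A v G H : v \in A -> H \in completions A G ->
  [set K in completions A G | label A v K == label A v H] = completions (A :\ v) H.
Proof.
move=> vA HG; rewrite -(completions_eq HG); apply/setP=> K; rewrite in_set.
apply/andP/completionsP=> [[/completionsP[sK dK oK] /eqP lE]|[sK dK oK]].
  have vE : nbhd K v = nbhd H v.
    apply/setP=> w; have [wA|wA] := boolP (w \in A).
      by have /setP/(_ w) := lE; rewrite !in_setI wA !andbT.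
    by rewrite nbhd_sym oK // nbhd_sym.
  split=> // u; first by apply: (@addIn (u \in nbhd K v)); rewrite -deg_inD1 // dK vE -deg_inD1.
  by rewrite in_setD1 negb_and negbK => /orP[/eqP->|/oK].
have vE : nbhd K v = nbhd H v by apply: oK; rewrite in_setD1 eqxx.
split; last by rewrite /label vE.
apply/completionsP; split=> // u; first by rewrite (deg_inD1 K u vA) dK vE -deg_inD1.
by move=> uA; apply: oK; rewrite in_setD1 (negbTE uA) andbF.
Qed.

(** The switch exists by [excess_neighbour], since v is adjacent to u and not to
u'. *)
Lemma shift_label A G H v u u' : v \in A -> H \in completions A G ->
    u \in label A v H -> u' \in A :\ v -> u' \notin label A v H ->
    deg_in A G u <= deg_in A G u' ->
  exists w, [/\ [/\ w \in A :\ v, w \in nbhd H u', w \notin nbhd H u & w != u],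
    switch H v u u' w \in completions A G &
    label A v (switch H v u u' w) = swap (label A v H) u u'].
Proof.
move=> vA HG uS; rewrite in_setD1 => /andP[nu'v u'A]; rewrite in_setI u'A andbT => u'v.
have sH := completions_simple HG; rewrite -!(completions_deg HG) => le.
case/setIP: uS => uv uA.
have [|||w [wA wu' wu nwu]] := excess_neighbour sH uA u'A vA _ _ _ le.
- by rewrite nbhd_sym.
- by rewrite nbhd_sym.
- by rewrite eq_sym.
exists w; split.
- split=> //; rewrite in_setD1 wA andbT.
  by apply: contraNneq u'v => <-; rewrite nbhd_sym.
- by rewrite -(completions_eq HG); apply: switch_completions.
- by apply: label_swap => //; apply: switch_nbhd_v.
Qed.

Definition compat (r : V -> nat) (d : V -> nat) := forall u w, r w < r u -> d u <= d w.

Lemma shifted_labels A G v r : v \in A -> simple_graph G -> compat r (deg_in A G) ->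
  shifted r (A :\ v) (labels A v G).
Proof.
move=> vA sG rd; split.
- by move=> _ _ /imsetP[H HG ->] /imsetP[K KG ->]; rewrite -!/(deg_in A _ v)
    !(completions_deg (A := A) (G := G)).
- move=> _ _ /imsetP[H HG ->] /imsetP[K KG ->].
  suff out L : L \in completions A G -> label A v L :\: (A :\ v) = set0 by rewrite !out.
  move=> LG; apply/eqP; rewrite setD_eq0; apply/subsetP=> w.
  exact: label_sub (completions_simple LG).
- move=> _ u w /imsetP[H HG ->] /setIP[uS uB] /setDP[wB wS] /rd le.
  have [x [_ KG <-]] := shift_label vA HG uS wB wS le.
  exact: imset_f.
Qed.

Lemma label_in A G v H : H \in completions A G -> label A v H \in labels A v G.
Proof. exact: imset_f. Qed.

(** A vertex z of C = T - a with d(z) <= d(a) could be traded for a in a graph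
with label f + C, and a vertex z outside T with d(z) >= d(b) could replace b
in a graph with label a + b + C - u. Both would produce a label that a pinched
family does not contain. *)
Lemma pinched_degree A G v r T a b : v \in A -> simple_graph G -> injective r ->
    compat r (deg_in A G) -> top r (A :\ v) T -> T \in labels A v G ->
    pinched r (labels A v G) (A :\ v) T a b ->
  deg_in A G b <= deg_in A G v <= deg_in A G a /\
  (forall z, z \in A -> z \notin [set v; a; b] ->
     ~~ (deg_in A G b <= deg_in A G z <= deg_in A G a)).
Proof.
move=> vA sG r_inj rd topT TF /pinchedP[[aTD bDT] _ [f [fDT nfb fF]] [u [uTD nua uF]] H].
have TB t : t \in T -> t \in A :\ v.
  by case/imsetP: TF => K KG -> /(label_sub (completions_simple KG)).
case/setIP: (aTD) => aT; rewrite in_setD1 => /andP[av aA].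
case/setDP: (bDT); rewrite in_setD1 => /andP[bv bA] bT.
case/setDP: (fDT); rewrite in_setD1 => /andP[fv fA] fT.
case/setIP: (uTD) => uT _.
have nab : a != b by apply: contraNneq bT => <-.
have nfa : f != a by apply: contraNneq fT => ->.
pose C := T :\ a.
have uC : u \in C by rewrite in_setD1 nua.
have CA : C \subset A.
  by apply/subsetP=> x /setD1P[_ /TB]; rewrite in_setD1 => /andP[].
have vC : v \notin C by apply/negP=> /setD1P[_ /TB]; rewrite in_setD1 eqxx.
have aC : a \notin C by rewrite in_setD1 eqxx.
have bC : b \notin C by rewrite in_setD1 (negbTE bT) andbF.
have fC : f \notin C by rewrite in_setD1 (negbTE fT) andbF.
have fvab : f \notin [set v; a; b] by rewrite !inE !negb_or fv nfa.
have [Y YG YE] := imsetP fF; have [Y2 Y2G Y2E] := imsetP uF.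
have {}YE : nbhd Y v :&: A = f |: C by rewrite -/(label A v Y) -YE.
have {}Y2E : nbhd Y2 v :&: A = a |: (b |: (C :\ u)).
  rewrite -/(label A v Y2) -Y2E; apply/setP=> x; rewrite in_swap !in_setU1 !in_setD1.
  case: (x =P a) => [->|_] /=; first by rewrite [a == u]eq_sym nua aT orbT.
  by case: (x == b).
have inD z : z \in A -> z \notin C -> z != v -> z = a \/ z \in (A :\ v) :\: T.
  move=> zA; rewrite in_setD1 negb_and negbK => /orP[/eqP|zT] nzv; first by left.
  by right; rewrite in_setD zT in_setD1 nzv.
have forb K w g : K \in completions A G -> w \in C -> g \in A -> g \notin [set v; a; b] ->
    g \notin C -> nbhd K v :&: A != g |: (a |: (C :\ w)).
  move=> KG /setD1P[nwa wT] gA gvab gC.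
  have /andP[/andP[gv ga] gb] : (g != v) && (g != a) && (g != b).
    by move: gvab; rewrite !inE !negb_or.
  have [Ega|gD] := inD g gA gC gv; first by rewrite Ega eqxx in ga.
  have wTD : w \in T :&: (A :\ v) by rewrite in_setI wT TB.
  apply: contraNneq (H w g wTD gD nwa gb) => E.
  have -> : swap T w g = label A v K; last exact: label_in.
  rewrite /label E; apply/setP=> x; rewrite in_swap !in_setU1 !in_setD1.
  by case: (x =P a) => [->|_] //=; rewrite [a == w]eq_sym nwa aT orbT.
have dmax z : z \in A -> z \notin C -> z != v -> deg_in A G z <= deg_in A G a.
  move=> zA zC nzv; have [-> //|zD] := inD z zA zC nzv.
  by apply: rd; apply: topT.
have dab : deg_in A G b <= deg_in A G a by apply: dmax.
have dmin : {in C, forall z, deg_in A G b <= deg_in A G z}.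
  move=> z /setD1P[_ zT]; apply: rd; apply: topT => //.
  by rewrite in_setI zT TB.
split.
  rewrite (pinched_deg_le vA aA bA nab CA vC av aC bv bC forb dmax
    fA fvab fC YG YE uC Y2G Y2E) andbT.
  exact: (pinched_deg_ge sG vA aA bA nab CA vC av aC bv bC forb dmin dab
    fA fvab fC YG YE uC Y2G Y2E).
move=> z zA zvab; move: (zvab); rewrite !inE !negb_or => /andP[/andP[zv za] zb].
rewrite negb_and -!ltnNge; have [zC|zC] := boolP (z \in C).
  rewrite orbC ltnNge; apply/orP; left; apply/negP=> le.
  have zS : z \in label A v Y by rewrite /label YE in_setU1 zC orbT.
  have aB : a \in A :\ v by rewrite in_setD1 av.
  have aS : a \notin label A v Y by rewrite /label YE in_setU1 negb_or [a == f]eq_sym nfa.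
  have [x [_ KG KE]] := shift_label vA YG zS aB aS le.
  have := forb _ _ _ KG zC fA fvab fC; rewrite -/(label A v _) KE /label YE.
  case/eqP; apply/setP=> y; rewrite in_swap !in_setU1 !in_setD1.
  case: (y =P f) => [->|_] /=; last by [].
  by rewrite andbT orbC; apply/orP; left; apply: contraNneq fC => ->.
rewrite ltnNge; apply/orP; left; apply/negP=> le.
have bS : b \in label A v Y2 by rewrite /label Y2E !in_setU1 eqxx orbT.
have zB : z \in A :\ v by rewrite in_setD1 zv.
have zS : z \notin label A v Y2.
  by rewrite /label Y2E !in_setU1 in_setD1 (negbTE za) (negbTE zb) (negbTE zC) andbF.
have [x [_ KG KE]] := shift_label vA Y2G bS zB zS le.
have := forb _ _ _ KG uC zA zvab zC; rewrite -/(label A v _) KE /label Y2E.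
case/eqP; apply/setP=> y; rewrite in_swap !in_setU1 !in_setD1.
case: (y =P b) => [->|_] //=.
by rewrite [b == a]eq_sym (negbTE nab) (negbTE bT) !andbF.
Qed.

Lemma rank_exists (key : V -> nat) : exists r : V -> nat,
  [/\ injective r, forall u w, r w < r u -> key u <= key w &
      forall u w, key u < key w -> r w < r u].
Proof.
pose M := \max_u key u; pose n := #|V|.
have keyM u : key u <= M by apply: leq_bigmax.
have rk u : enum_rank u < n by [].
have mono u w : key u < key w ->
   (M - key w) * n + enum_rank w < (M - key u) * n + enum_rank u.
  move=> lt; apply: leq_trans (_ : (M - key w).+1 * n <= _).
    by rewrite mulSn [n + _]addnC ltn_add2l.
  apply: leq_trans (leq_addr _ _); rewrite leq_mul2r; apply/orP; right.
  by rewrite ltn_sub2l // (leq_trans lt).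
exists (fun u => (M - key u) * n + enum_rank u); split=> // u w.
- move=> E; have [lt|lt|Ek] := ltngtP (key u) (key w).
  + by have := mono _ _ lt; rewrite E ltnn.
  + by have := mono _ _ lt; rewrite E ltnn.
  + by move/eqP: E; rewrite Ek eqn_add2l => /eqP/val_inj/enum_rank_inj.
- by move=> lt; rewrite leqNgt; apply/negP=> /mono; rewrite ltnNge (ltnW lt).
Qed.

End Labels.

(** * Induction on the set of free vertices *)

Section Induction.
Variable V : finType.
Implicit Types (G H K Y : {set {set V}}) (A B C S T : {set V}) (a b c p q t u v w z : V).

Definition switch_adj G H := #|symdiff G H| == 4.

Local Notation hpx := (hpath (@exchange V)).
Local Notation hpg := (hpath switch_adj).

Definition exit A a b G :=
  [exists c in A, [&& c \in nbhd G b, c \notin nbhd G a & c != a]].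

Lemma exitP A a b G : reflect
  (exists c, [/\ c \in A, c \in nbhd G b, c \notin nbhd G a & c != a]) (exit A a b G).
Proof.
apply: (iffP exists_inP) => [[c cA /and3P[? ? ?]]|[c [cA cb ca nca]]].
  by exists c.
by exists c; rewrite ?cb ?ca.
Qed.

Definition ham_from A := forall G, simple_graph G -> exists K, hpg (completions A G) G K.

Definition ham_exit A := forall G a b, simple_graph G -> a \in A -> b \in A ->
  a != b -> (exists2 H, H \in completions A G & exit A a b H) ->
  exists2 K, hpg (completions A G) G K & exit A a b K.

(** If all neighbours of b were neighbours of a, the degree of a would be at
least that of b. *)
Lemma exit_of_lt A a b G : simple_graph G -> a \in A -> b \in A ->
  deg_in A G a < deg_in A G b -> exit A a b G.
Proof.
move=> sG aA bA lt; apply: contraLR lt => none; rewrite -leqNgt.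
have sub : (nbhd G b :&: A) :\ a \subset (nbhd G a :&: A) :\ b.
  apply/subsetP=> c; rewrite !(in_setD1, in_setI) => /and3P[nca cb cA].
  rewrite (nbhd_neq sG cb) cA andbT /=; apply: contraNT none => ca.
  by apply/exitP; exists c.
have := subset_leq_card sub; have := cardsD1 a (nbhd G b :&: A).
have := cardsD1 b (nbhd G a :&: A); rewrite !in_setI aA bA [b \in nbhd G a]nbhd_sym /deg_in.
move: #|_ :\ _| #|_ :\ _| #|_ :&: _| #|_ :&: _| => i j k l.
by case: (a \in nbhd G b) => /=; clear; lia.
Qed.

Section Vertex.
Variables (A : {set V}) (v : V).
Hypotheses (vA : v \in A) (IHP : ham_from (A :\ v)) (IHQ : ham_exit (A :\ v)).

(** If d(u) <= d(u'), then y itself is an exit by [shift_label]. Otherwise any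
graph with the other label has a switch that trades u' for u, and the result is
an exit, as the switch can be undone. *)
Lemma exit_step G y u u' : simple_graph G -> y \in completions A G ->
    u \in label A v y -> u' \notin label A v y ->
    swap (label A v y) u u' \in labels A v G ->
  exists2 H, H \in completions (A :\ v) y & exit (A :\ v) u u' H.
Proof.
move=> sG yG uS u'S kF; have sy := completions_simple yG.
have uB := label_sub sy uS.
have [y' y'G kE] := imsetP kF; have sy' := completions_simple y'G.
have u'B : u' \in A :\ v.
  by apply: (label_sub (A := A) (v := v) sy'); rewrite -kE in_swap eqxx.
have nuu' : u != u' by apply: contraNneq u'S => <-.
have [le|/ltnW le] := leqP (deg_in A G u) (deg_in A G u').
  have [w [[wB wu' wu nwu] _ _]] := shift_label vA yG uS u'B u'S le.
  by exists y; [apply: completions_refl|apply/exitP; exists w].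
have u'S' : u' \in label A v y' by rewrite -kE in_swap eqxx.
have uS' : u \notin label A v y' by rewrite -kE in_swap eqxx orbF.
have [w [[wB wu wu' nwu'] KG KE]] := shift_label vA y'G u'S' uB uS' le.
set K := switch y' v u' u w in KG KE; exists K.
  rewrite -(fiberE vA yG) inE KG KE -kE; apply/eqP/setP=> x; rewrite !in_swap.
  case: (x =P u) => [->|_] //=; case: (x =P u') => [->|] //=.
  by rewrite (negbTE u'S).
move: (u'S') (uS'); rewrite !in_setI.
case/setD1P: (u'B) => nu'v u'A; case/setD1P: (uB) => nuv uA.
rewrite u'A uA !andbT => u'v uv.
have wE : nbhd K w = swap (nbhd y' w) u u' by apply: switch_nbhd_w.
apply/exitP; exists w; split=> //.
- by rewrite nbhd_sym wE in_swap eqxx.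
- by rewrite nbhd_sym wE in_swap eqxx orbF.
- exact: nbhd_neq wu.
Qed.

Lemma lift_hpath G S (good : {set {set V}} -> Prop) : simple_graph G ->
    hpx (labels A v G) (label A v G) S ->
    (forall y, y \in completions A G -> label A v y = S ->
      exists2 z, hpg (completions (A :\ v) y) y z & good z) ->
  exists2 K, hpg (completions A G) G K & good K.
Proof.
move=> sG pS fin; have GG := completions_refl A sG.
apply: (hpath_lift (f := label A v) _ _ GG pS) => [y k yG kF|y]; last first.
  rewrite inE => /andP[yG /eqP lE]; have [z hz gz] := fin y yG lE.
  by exists z => //; rewrite -lE fiberE.
case/exchangeP=> u [u' [uS u'S kE]]; rewrite kE in kF; have sy := completions_simple yG.
have uB := label_sub sy uS.
have u'B : u' \in A :\ v.
  have [y' y'G E] := imsetP kF.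
  by apply: (label_sub (A := A) (v := v) (completions_simple y'G)); rewrite -E in_swap eqxx.
have nuu' : u != u' by apply: contraNneq u'S => <-.
have [z hz /exitP[c [cB cu' cu ncu]]] :=
  IHQ sy uB u'B nuu' (exit_step sG yG uS u'S kF).
have zB := hpath_end hz; have sz := completions_simple zB.
have : z \in [set K in completions A G | label A v K == label A v y] by rewrite fiberE.
rewrite inE => /andP[zG /eqP lz].
case/setD1P: (u'B) => nu'v u'A; case/setD1P: (uB) => nuv uA.
case/setD1P: cB => ncv cA.
have uz : u \in nbhd z v by move: uS; rewrite -lz in_setI uA andbT.
have u'z : u' \notin nbhd z v by move: u'S; rewrite -lz in_setI u'A andbT.
exists z, (switch z v u u' c); split.
- by rewrite fiberE.
- rewrite inE -(completions_eq zG) switch_completions //= kE -lz.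
  by apply/eqP; apply: label_swap => //; apply: switch_nbhd_v.
- by rewrite /switch_adj switch_symdiff.
Qed.

End Vertex.

Lemma completions0 G : simple_graph G -> completions set0 G = [set G].
Proof.
move=> sG; apply/setP=> H; rewrite inE; apply/idP/eqP=> [HG|->]; last exact: completions_refl.
apply: (graph_ext (completions_simple HG) sG) => u.
by case/completionsP: HG => _ _; apply; rewrite inE.
Qed.

Lemma ham_from_step A : (forall v, v \in A -> ham_from (A :\ v) /\ ham_exit (A :\ v)) ->
  ham_from A.
Proof.
move=> IH G sG; have [->|[v vA]] := set_0Vmem A.
  by exists G; rewrite completions0 //; apply: hpath1.
have [IHP IHQ] := IH v vA.
have [r [r_inj rd _]] := rank_exists (deg_in A G).
have shF : shifted r (A :\ v) (labels A v G) by apply: shifted_labels.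
have [S pS] := shifted_hpath r_inj shF (label_in v (completions_refl A sG)).
suff fin y : y \in completions A G -> label A v y = S ->
    exists2 z, hpg (completions (A :\ v) y) y z & True.
  by have [K hK _] := lift_hpath vA IHQ sG pS fin; exists K.
by move=> yG _; have [z hz] := IHP y (completions_simple yG); exists z.
Qed.

Section Exit.
Variables (A : {set V}) (G : {set {set V}}) (a b : V).
Hypothesis IH : forall v, v \in A -> ham_from (A :\ v) /\ ham_exit (A :\ v).
Hypotheses (sG : simple_graph G) (aA : a \in A) (bA : b \in A) (nab : a != b).
Hypothesis le_ba : deg_in A G b <= deg_in A G a.

(** This is the sum of the degrees of u before and after an edge is moved from
b to a, up to a constant. Ordering by it makes the label families of both
degree functions shifted with respect to the same rank. *)
Definition key u := 2 * deg_in A G u + (u == a) + (u != b).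

Variable r : V -> nat.
Hypotheses (r_inj : injective r) (r_key : forall u w, r w < r u -> key u <= key w)
  (key_r : forall u w, key u < key w -> r w < r u).

Let deg_ab t : [/\ t == a -> deg_in A G t = deg_in A G a, t == b -> deg_in A G t = deg_in A G b &
  ~~ ((t == a) && (t == b))].
Proof.
split=> [/eqP-> //|/eqP-> //|].
by apply: contra nab => /andP[/eqP<- /eqP<-].
Qed.

Lemma compat_deg : compat r (deg_in A G).
Proof.
move=> u w /r_key; rewrite /key; move: le_ba (deg_ab u) (deg_ab w).
move: (deg_in A G u) (deg_in A G w) (deg_in A G a) (deg_in A G b) => i j k l.
case: (u == a); case: (u == b); case: (w == a); case: (w == b);
  clear => le [Ha Hb H] [Ha' Hb' H'] //=;
  lia.
Qed.

Lemma r_ab : r a < r b.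
Proof.
apply: key_r; rewrite /key !eqxx [b == a]eq_sym (negbTE nab).
by move: le_ba; move: (deg_in A G _) (deg_in A G _) => i j; clear; lia.
Qed.

Section Exists.
Variables (H0 : {set {set V}}) (c : V).
Hypotheses (H0G : H0 \in completions A G) (cA : c \in A) (cb : c \in nbhd H0 b)
  (ca : c \notin nbhd H0 a) (nca : c != a).

Let sH0 : simple_graph H0. Proof. exact: completions_simple H0G. Qed.

Let mcba : movable H0 c b a.
Proof. by rewrite /movable nbhd_sym cb nbhd_sym ca eq_sym. Qed.

Let G1 := move_edge H0 c b a.
Let sG1 : simple_graph G1. Proof. exact: move_simple. Qed.

Let deg_moved t : deg_in A G1 t + (t == b) = deg_in A G t + (t == a).
Proof. by rewrite (move_deg sH0 mcba) // (completions_deg H0G). Qed.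

Let compat_moved : compat r (deg_in A G1).
Proof.
move=> u w /r_key; rewrite /key; move: le_ba (deg_ab u) (deg_ab w) (deg_moved u) (deg_moved w).
move: (deg_in A G u) (deg_in A G w) (deg_in A G a) (deg_in A G b) (deg_in A G1 u)
  (deg_in A G1 w) => i j k l m n.
case: (u == a); case: (u == b); case: (w == a); case: (w == b);
  clear => le [Ha Hb H] [Ha' Hb' H'] //=;
  lia.
Qed.

(** Moving the edge cb to ca in an exit yields degrees with a surplus at a. The
labels of v for these degrees form a shifted family as well, so T is one of
them. In a graph with this label a has at least two neighbours that b lacks,
one of which is a vertex q != v; moving qa to qb restores the degrees, and q
witnesses an exit that does not involve v. *)
Lemma top_exit v T : v \in A -> v != a -> v != b -> T \in labels A v G ->
    top r (A :\ v) T ->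
  exists y, [/\ y \in completions A G, label A v y = T & exit (A :\ v) a b y].
Proof.
move=> vA nva nvb TF topT.
have sh1 : shifted r (A :\ v) (labels A v G1) by apply: shifted_labels.
have G1F := label_in v (completions_refl A sG1).
have [Y YG EY] := imsetP TF.
have cT : #|T| = #|label A v G1|.
  have := deg_moved v; rewrite (negbTE nva) (negbTE nvb) !addn0 => E.
  by rewrite EY -!/(deg_in A _ v) (completions_deg YG) E.
have oT : T :\: (A :\ v) = label A v G1 :\: (A :\ v).
  transitivity (set0 : {set V}); [|apply/esym]; apply/eqP; rewrite setD_eq0; apply/subsetP=> x.
    by rewrite EY; apply: label_sub; apply: completions_simple YG.
  exact: label_sub.
have := top_mem sh1 topT G1F cT oT => /imsetP[z zG1 Ez].
have sz := completions_simple zG1.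
have da : deg_in A z a = (deg_in A G a).+1.
  have := deg_moved a; rewrite eqxx (negbTE nab) addn0 (completions_deg zG1) addn1; by [].
have db : (deg_in A z b).+1 = deg_in A G b.
  have := deg_moved b; rewrite eqxx eq_sym (negbTE nab) addn0 -(completions_deg zG1) addn1; by [].
pose X := (nbhd z a :&: A) :\ b; pose W := (nbhd z b :&: A) :\ a.
have cXW : #|W| + 2 <= #|X|.
  have := cardsD1 a (nbhd z b :&: A); have := cardsD1 b (nbhd z a :&: A).
  rewrite !in_setI aA bA [b \in nbhd z a]nbhd_sym !andbT -/X -/W -!/(deg_in A _ _).
  move: le_ba; rewrite -db da.
  move: (deg_in A G a) (deg_in A z b) #|X| #|W| => i j k l.
  by case: (a \in nbhd z b); clear; lia.
have [q] : exists q, q \in (X :\: W) :\ v.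
  apply/set0Pn; rewrite -card_gt0.
  have := cardsD1 v (X :\: W); have := cardsID W X.
  have := subset_leq_card (subsetIr X W); move: cXW.
  move: #|X| #|W| #|X :&: W| #|X :\: W| #|_ :\ _| (v \in _ : bool) => i j k l m [];
  clear; lia.
case/setD1P=> nqv /setDP[/setD1P[nqb /setIP[qa qA]] qW].
have nqa := nbhd_neq sz qa.
have qb : q \notin nbhd z b by apply: contraNN qW => qb; rewrite in_setD1 in_setI nqa qb.
have mq : movable z q a b by rewrite /movable nbhd_sym qa nbhd_sym qb eq_sym.
pose y := move_edge z q a b.
have yE : label A v y = T.
  by rewrite Ez /label /y move_nbhd_other // eq_sym.
exists y; split=> //.
  apply/completionsP; split; first exact: move_simple.
    move=> t; have := move_deg sz mq t bA aA qA; rewrite -/y (completions_deg zG1).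
    have := deg_moved t; move: (deg_in A y t) (deg_in A G1 t) (deg_in A G t) => i j k.
    by case: (t == a); case: (t == b); clear; lia.
  move=> t tA; rewrite /y (move_out _ bA aA qA tA).
  have [_ _ ->] := completionsP _ _ _ zG1; last by [].
  by rewrite /G1 (move_out _ aA bA cA tA); have [_ _ ->] := completionsP _ _ _ H0G.
apply/exitP; exists q; split=> //; first by rewrite in_setD1 nqv.
  by rewrite /y (move_nbhd_a mq) in_setU1 eqxx.
by rewrite /y (move_nbhd_b sz mq) in_setD1 eqxx.
Qed.

(** Both T and the label of Y belong to fibres that contain exits: in the
latter case v itself is a witness in every graph of the fibre. *)
Lemma exit_via v Y : v \in A -> v != a -> v != b -> Y \in completions A G ->
    b \in nbhd Y v -> a \notin nbhd Y v ->
  (exists2 K, hpg (completions A G) G K & exit A a b K) \/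
  (deg_in A G b <= deg_in A G v <= deg_in A G a /\
   (forall z, z \in A -> z \notin [set v; a; b] ->
     ~~ (deg_in A G b <= deg_in A G z <= deg_in A G a))).
Proof.
move=> vA nva nvb YG bY aY; have [IHP IHQ] := IH vA.
have shF : shifted r (A :\ v) (labels A v G) by apply: shifted_labels compat_deg.
have GF := label_in v (completions_refl A sG); have YF := label_in v YG.
have [T TF topT] := top_exists r_inj shF GF.
have aB : a \in A :\ v by rewrite in_setD1 eq_sym nva.
have bB : b \in A :\ v by rewrite in_setD1 eq_sym nvb.
have bS : b \in label A v Y by rewrite in_setI bY.
have aS : a \notin label A v Y by rewrite in_setI negb_and aY.
have [rc|[S ES hS]] := end_choice r_inj shF topT TF GF YF aB bB r_ab bS aS.
  by right; apply: pinched_degree rc => //; apply: compat_deg.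
left; apply: (lift_hpath vA IHQ sG hS) => y yG yS; have sy := completions_simple yG.
case: ES => ES.
  have [y' [y'G y'T ex']] := top_exit vA nva nvb TF topT.
  have y'y : y' \in completions (A :\ v) y by rewrite -(fiberE vA yG) inE y'G y'T yS ES /=.
  have [K hK /exitP[q [qB qb qa nqa]]] := IHQ y a b sy aB bB nab (ex_intro2 _ _ y' y'y ex').
  by exists K => //; apply/exitP; exists q; split=> //; case/setD1P: qB.
have [K hK] := IHP y sy; exists K => //; have KB := hpath_end hK.
have : K \in [set L in completions A G | label A v L == label A v y] by rewrite fiberE.
rewrite inE yS ES => /andP[KG /eqP lK].
apply/exitP; exists v; split=> //.
  by rewrite nbhd_sym; move: bS; rewrite -lK in_setI => /andP[].
by rewrite nbhd_sym; move: aS; rewrite -lK in_setI aA andbT.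
Qed.

(** The switch on c and w makes w, which is adjacent to a and not to b, a
witness too. So [exit_via] applies to both c and w, and its second alternative
for c excludes the one for w. *)
Lemma exit_ham : exists2 K, hpg (completions A G) G K & exit A a b K.
Proof.
have ncb := nbhd_neq sH0 cb.
have le0 : deg_in A H0 b <= deg_in A H0 a by rewrite !(completions_deg H0G).
have [w [wA wa wb nwb]] := excess_neighbour sH0 bA aA cA cb ca nca le0.
have nwa := nbhd_neq sH0 wa.
have bc : b \in nbhd H0 c by rewrite nbhd_sym.
have ac : a \notin nbhd H0 c by rewrite nbhd_sym.
have [//|[_ out_c]] := exit_via cA nca ncb H0G bc ac.
have aw : a \in nbhd H0 w by rewrite nbhd_sym.
have bw : b \notin nbhd H0 w by rewrite nbhd_sym.
have nbw : b != w by rewrite eq_sym.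
have KG : switch H0 w a b c \in completions A G by rewrite -(completions_eq H0G) switch_completions.
have wE : nbhd (switch H0 w a b c) w = swap (nbhd H0 w) a b by rewrite switch_nbhd_v.
have [||//|[in_w _]] := exit_via wA nwa nwb KG.
- by rewrite wE in_swap eqxx.
- by rewrite wE in_swap eqxx orbF.
have := out_c w wA; rewrite in_w !inE (negbTE nwa) (negbTE nwb) !orbF => H.
suff /H : w != c by [].
by apply: contraNneq wb => ->.
Qed.

End Exists.
End Exit.

Lemma ham_exit_step A : (forall v, v \in A -> ham_from (A :\ v) /\ ham_exit (A :\ v)) ->
  ham_exit A.
Proof.
move=> IH G a b sG aA bA nab [H HG /exitP[c [cA cb ca nca]]].
have [le|lt] := leqP (deg_in A G b) (deg_in A G a).
  have [r [r_inj r_key key_r]] := rank_exists (key A G a b).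
  exact: (exit_ham IH sG aA bA nab le r_inj r_key key_r HG cA cb ca nca).
have [K hK] := ham_from_step IH sG; exists K => //.
have KG := hpath_end hK.
by apply: exit_of_lt (completions_simple KG) aA bA _; rewrite !(completions_deg KG).
Qed.

Lemma ham_all A : ham_from A /\ ham_exit A.
Proof.
move: {2}#|A| (leqnn #|A|) => n; elim: n A => [|n IH] A leA.
  have IH0 v : v \in A -> ham_from (A :\ v) /\ ham_exit (A :\ v).
    by move: leA; rewrite leqn0 cards_eq0 => /eqP->; rewrite inE.
  by split; [apply: ham_from_step|apply: ham_exit_step].
have IH' v : v \in A -> ham_from (A :\ v) /\ ham_exit (A :\ v).
  by move=> vA; apply: IH; move: leA; rewrite (cardsD1 v) vA.
by split; [apply: ham_from_step|apply: ham_exit_step].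
Qed.

End Induction.

(** * Realization graphs *)

Section Realizations.
Variable V : finType.
Implicit Types (G H : {set {set V}}) (u w : V).

Lemma deg_setT G u : simple_graph G -> deg G u = deg_in setT G u.
Proof.
move=> sG; rewrite /deg /deg_in setIT.
have -> : [set e in G | u \in e] = [set [set u; w] | w in nbhd G u].
  apply/setP=> e; apply/setIdP/imsetP=> [[eG ue]|[w wG ->]]; last first.
    by rewrite -in_nbhd wG set21.
  have /cards2P[p [q [_ E]]] := forall_inP sG e eG.
  move: ue eG; rewrite E => /set2P[] -> eG; first by exists q; rewrite ?in_nbhd.
  by exists p; rewrite ?in_nbhd setUC.
rewrite card_imset // => w w' /eqP; rewrite set2_eq eqxx /=.
by case/orP=> [/eqP //|/andP[/eqP-> /eqP]].
Qed.

Lemma realization_completions (d : V -> 'I_#|V|) G H :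
  is_realization d G -> (H \in completions setT G) = is_realization d H.
Proof.
case/andP=> sG /forallP dG; apply/completionsP/andP=> [[sH dH _]|[sH /forallP dH]].
  by split=> //; apply/forallP=> u; rewrite deg_setT // dH -deg_setT.
split=> // u; last by rewrite inE.
by rewrite -!deg_setT // (eqP (dG u)) (eqP (dH u)).
Qed.

End Realizations.

Theorem corollary10p2 (V : finType) (d : V -> 'I_#|V|) :
  graphical d -> homogeneously_traceable (@realization_graph V d).
Proof.
move=> _ x; have xR := valP x.
have [sx _] := andP xR; have [ham _] := ham_all (V := V) setT.
have [K [p [pathp uniqp memp _]]] := ham _ sx.
have [q Eq] : exists q : seq (realization d), map val q = p.
  have : all (is_realization d) p.
    by apply/allP=> H Hp; rewrite -(realization_completions _ xR) -memp inE Hp orbT.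
  elim: p {pathp uniqp memp} => [|H p IH] /=; first by exists [::].
  by case/andP=> HR /IH[q <-]; exists (exist _ H HR :: q).
exists q; apply/and3P; split.
- by move: pathp; rewrite -Eq path_map.
- by move: uniqp; rewrite -Eq -map_cons (map_inj_uniq val_inj).
- apply/forallP=> y; rewrite -(mem_map val_inj) map_cons Eq memp.
  by rewrite (realization_completions _ xR); apply: valP.
Qed.
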